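(* (i) For every integer $m\ge 1$, $$ d(m)\le \sqrt{2}\, m \exp\left(-\sqrt{\log 2 \,\log m + (\log 2)^2/4}\right). $$ (ii) There exist an infinite set $\mathcal{M}$ of positive integers and a function $\varepsilon:\mathcal{M}\to\mathbb{R}$ with $\varepsilon(m)\to 0$ as $m\to\infty$, $m\in\mathcal{M}$, such that for all $m\in\mathcal{M}$ (large enough that the expression is defined) $$ f(m)\ge m^{1-(1+\varepsilon(m))\log\log\log m/\log\log m}. $$
   Context: For a positive integer $m$, let $\varphi(m)$ be Euler's function and $\lambda(m)$ the Carmichael function (the exponent of the multiplicative group $(\mathbb{Z}/m\mathbb{Z})^*$); recall $\lambda(m)=\mathrm{lcm}[\lambda(p_1^{r_1}),\dots,\lambda(p_k^{r_k})]$ for $m=p_1^{r_1}\cdots p_k^{r_k}$, with $\lambda(p^r)=p^{r-1}(p-1)$ except $\lambda(2^r)=2^{r-2}$ for $r\ge 3$. Let $\mathrm{rad}(m)$ be the product of the distinct primes dividing $m$. Let $\delta=2$ if $4\mid m$ and $\delta=1$ otherwise. Define $$ d(m)=\gcd\big(m,\ \delta\,\varphi(\mathrm{rad}(m))\big),\qquad f(m)=\gcd\big(m,\ \delta\,\lambda(m)\varphi(\mathrm{rad}(m))/\varphi(m)\big). $$ *)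

(* Defs.v *)
From mathcomp Require Import all_boot.
From Stdlib Require Import Reals.

Set Implicit Arguments.
Unset Strict Implicit.
Unset Printing Implicit Defensive.

Definition carmichael_pp (p r : nat) : nat :=
  if (p == 2) && (3 <= r) then 2 ^ (r - 2) else p ^ (r - 1) * (p - 1).

Definition carmichael (m : nat) : nat :=
  \big[lcmn/1]_(p <- primes m) carmichael_pp p (logn p m).

Definition rad (m : nat) : nat := \prod_(p <- primes m) p.

Definition delta (m : nat) : nat := if 4 %| m then 2 else 1.

Definition d_fun (m : nat) : nat := gcdn m (delta m * totient (rad m)).

(* delta * lambda(m) * phi(rad m) / phi(m) is an integer; %/ is exact here. *)
Definition f_fun (m : nat) : nat :=
  gcdn m ((delta m * carmichael m * totient (rad m)) %/ totient m).

(* Main.v *)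
From Stdlib Require Import Reals Lra.
From HB Require Import structures.
From mathcomp Require Import all_boot zify.
Require Import Defs.

(** (i) Put n = m / d(m) and give a prime q the weight
    w(q) = (l^2 + l) / 2 - 1 with l = log2 q. This weight satisfies
    log2 (q - 1) + sum_(p | q - 1) w(p) <= w(q). Every prime of m that does not
    divide n divides q - 1 for some prime q of m, so summing over the primes of m
    leaves log2 d(m) <= 1 + w(n), which is the claim after completing the square.

    (ii) For squarefree m one has f(m) = gcd(m, lambda(m)) up to delta. Starting
    from a prime q, repeatedly replace each prime p by the large prime factors of
    p - 1; the product m of all primes met in k generations satisfies
    f(m) >= m / q. If no prime is met twice and the smooth part of p - 1 lost at
    each step is small, every generation has product about q, so f(m) >= m^(1 - 1/k)
    roughly. A union bound in logarithmic density shows that a suitable q exists: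
    collisions are negligible, and along a chain of primes the exponential moment of
    the total smooth part grows only by a factor polynomial in k per generation,
    because Brun's pure sieve bounds the sum of 1/b over the b with m b + 1 prime.
    This works as soon as log q is about k^k, that is k ~ loglog m / logloglog m. *)

Set Implicit Arguments.
Unset Strict Implicit.
Unset Printing Implicit Defensive.

(** The obstacle is uniformity in the depth k. Primes in progressions are bounded only from above,
    with the loss of a power of log L for primes up to 2^L. As log L is of order k log k, each
    generation multiplies the moment by a power of k, and a good root is only known to have total
    log-weight O(k log k). The cutoffs absorb this. The exponent h j of the cutoff 2^(h j) grows by
    a factor rho per level, so a node above level j + 1 is at least the rho-th power of the cutoff
    that defines the smooth part lost at it. The relative loss of mass is then O(k log k / rho), and
    with k = 2^g and rho = k g^2 it is O(1/g). This growth is what makes log q as large as k^k. A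
    lower bound for primes enters once, through Chebyshev, to supply candidates for the root. *)

Lemma RplusA : associative Rplus.
Proof. by move=> x y z; rewrite Rplus_assoc. Qed.
Lemma RmultA : associative Rmult.
Proof. by move=> x y z; rewrite Rmult_assoc. Qed.

HB.instance Definition _ := Monoid.isComLaw.Build R R0 Rplus RplusA Rplus_comm Rplus_0_l.
HB.instance Definition _ := Monoid.isComLaw.Build R R1 Rmult RmultA Rmult_comm Rmult_1_l.
HB.instance Definition _ := Monoid.isMulLaw.Build R R0 Rmult Rmult_0_l Rmult_0_r.
HB.instance Definition _ := Monoid.isAddLaw.Build R Rmult Rplus
  (fun x y z => Rmult_plus_distr_r x y z) (fun x y z => Rmult_plus_distr_l x y z).

Local Open Scope R_scope.

Notation "\rsum_ ( i <- r | P ) F" := (\big[Rplus/R0]_(i <- r | P%B) F)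
  (at level 41, F at level 41, i, r at level 50).
Notation "\rsum_ ( i <- r ) F" := (\big[Rplus/R0]_(i <- r) F)
  (at level 41, F at level 41, i, r at level 50).
Notation "\rprod_ ( i <- r | P ) F" := (\big[Rmult/R1]_(i <- r | P%B) F)
  (at level 36, F at level 36, i, r at level 50).
Notation "\rprod_ ( i <- r ) F" := (\big[Rmult/R1]_(i <- r) F)
  (at level 36, F at level 36, i, r at level 50).

(** * Casts, finite sums and finite products over the reals *)

Lemma INR_addn a b : INR (a + b)%N = INR a + INR b.
Proof. exact: plus_INR. Qed.
Lemma INR_muln a b : INR (a * b)%N = INR a * INR b.
Proof. exact: mult_INR. Qed.
Lemma INR_expn a b : INR (a ^ b)%N = INR a ^ b.
Proof. by elim: b => [|b IH]; rewrite ?expn0 // expnS INR_muln IH. Qed.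
Lemma INR_leq a b : (a <= b)%N -> INR a <= INR b.
Proof. by move=> H; apply: le_INR; lia. Qed.
Lemma INR_ltn a b : (a < b)%N -> INR a < INR b.
Proof. by move=> H; apply: lt_INR; lia. Qed.
Lemma INR_ge1 a : (0 < a)%N -> 1 <= INR a.
Proof. by move=> H; apply: (INR_leq H). Qed.
Lemma INR_gt0 a : (0 < a)%N -> 0 < INR a.
Proof. by move=> H; have := INR_ge1 H; lra. Qed.
Lemma INR_prime_ge2 p : prime p -> 2 <= INR p.
Proof. by move/prime_gt1/INR_leq; rewrite /=. Qed.
Lemma INR_subn1 a : (0 < a)%N -> INR (a - 1)%N = INR a - 1.
Proof. by move=> H; rewrite minus_INR //; lia. Qed.

Section Sums.
Variable I : eqType.
Implicit Types (s : seq I) (P Q : pred I) (F G : I -> R).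

Lemma rsum_ge0 s P F : (forall i, i \in s -> P i -> 0 <= F i) ->
  0 <= \rsum_(i <- s | P i) F i.
Proof.
move=> H; rewrite big_seq_cond; elim/big_rec: _ => [|i x /andP[Hi Pi] Hx]; first lra.
by have := H i Hi Pi; lra.
Qed.

Lemma rsum_le s P F G : (forall i, i \in s -> P i -> F i <= G i) ->
  \rsum_(i <- s | P i) F i <= \rsum_(i <- s | P i) G i.
Proof.
move=> H; rewrite [X in X <= _]big_seq_cond [X in _ <= X]big_seq_cond.
elim/big_rec2: _ => [|i x y /andP[Hi Pi] Hx]; first lra.
by have := H i Hi Pi; lra.
Qed.

Lemma rsum_mull s P F c : \rsum_(i <- s | P i) (c * F i) = c * \rsum_(i <- s | P i) F i.
Proof. by rewrite big_distrr. Qed.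

Lemma rsum_pred_le s P Q F : (forall i, i \in s -> 0 <= F i) ->
  (forall i, i \in s -> P i -> Q i) ->
  \rsum_(i <- s | P i) F i <= \rsum_(i <- s | Q i) F i.
Proof.
move=> HF H; rewrite big_mkcond [X in _ <= X]big_mkcond; apply: rsum_le => i Hi _.
by case: ifP => [/(H _ Hi) -> |_]; [lra|case: ifP => _; [exact: HF|lra]].
Qed.

Lemma rsum_subset s s' F : uniq s -> {subset s <= s'} ->
  (forall i, i \in s' -> 0 <= F i) -> \rsum_(i <- s) F i <= \rsum_(i <- s') F i.
Proof.
elim: s s' => [|x s IH] s' /=.
  by move=> _ _ H; rewrite big_nil; apply: rsum_ge0 => i Hi _; apply: H.
case/andP=> xs us sub F0.
have xs' : x \in s' by apply: sub; rewrite mem_head.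
rewrite big_cons (perm_big _ (perm_to_rem xs')) big_cons /=.
suff : \rsum_(i <- s) F i <= \rsum_(i <- rem x s') F i by lra.
apply: IH => // [i Hi|i /mem_rem]; last exact: F0.
have : i \in x :: rem x s' by rewrite -(perm_mem (perm_to_rem xs')) sub // inE Hi orbT.
by rewrite inE => /orP[/eqP ix|//]; rewrite -ix Hi in xs.
Qed.

Lemma rsum_const s c : \rsum_(i <- s) c = INR (size s) * c.
Proof.
elim: s => [|x s IH]; first by rewrite big_nil /=; lra.
by rewrite big_cons IH -[size (x :: s)]/((size s).+1) S_INR; ring.
Qed.

Lemma rsum_ge_term s F x : x \in s -> (forall i, i \in s -> 0 <= F i) ->
  F x <= \rsum_(i <- s) F i.
Proof.
move=> xs F0; rewrite (perm_big _ (perm_to_rem xs)) big_cons /=.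
have : 0 <= \rsum_(i <- rem x s) F i by apply: rsum_ge0 => i /mem_rem Hi _; apply: F0.
by lra.
Qed.

Lemma rprod_ge0 s P F : (forall i, i \in s -> P i -> 0 <= F i) ->
  0 <= \rprod_(i <- s | P i) F i.
Proof.
move=> H; rewrite big_seq_cond; elim/big_rec: _ => [|i x /andP[Hi Pi] Hx]; first lra.
by have := H i Hi Pi; nra.
Qed.

Lemma rprod_gt0 s P F : (forall i, i \in s -> P i -> 0 < F i) ->
  0 < \rprod_(i <- s | P i) F i.
Proof.
move=> H; rewrite big_seq_cond; elim/big_rec: _ => [|i x /andP[Hi Pi] Hx]; first lra.
by have := H i Hi Pi; nra.
Qed.

Lemma rprod_le1 s P F : (forall i, i \in s -> P i -> 0 <= F i <= 1) ->
  0 <= \rprod_(i <- s | P i) F i <= 1.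
Proof.
move=> H; rewrite big_seq_cond; elim/big_rec: _ => [|i x /andP[Hi Pi] Hx]; first lra.
by have := H i Hi Pi; nra.
Qed.

Lemma ln_rprod s P F : (forall i, i \in s -> P i -> 0 < F i) ->
  ln (\rprod_(i <- s | P i) F i) = \rsum_(i <- s | P i) ln (F i).
Proof.
elim: s => [|x s IH] H; first by rewrite !big_nil ln_1.
have H' : forall i, i \in s -> P i -> 0 < F i by move=> i Hi; apply: H; rewrite inE Hi orbT.
rewrite !big_cons; case: ifP => Px; last exact: IH.
rewrite ln_mult ?IH //; [by apply: H; rewrite ?mem_head|exact: rprod_gt0].
Qed.

Lemma exp_rsum s P F :
  exp (\rsum_(i <- s | P i) F i) = \rprod_(i <- s | P i) exp (F i).
Proof.
elim: s => [|x s IH]; first by rewrite !big_nil exp_0.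
by rewrite !big_cons; case: ifP => Px //; rewrite exp_plus IH.
Qed.

End Sums.

Lemma INR_prod (I : eqType) (s : seq I) (P : pred I) (F : I -> nat) :
  INR (\prod_(i <- s | P i) F i) = \rprod_(i <- s | P i) INR (F i).
Proof. by apply: (big_morph INR INR_muln). Qed.

Lemma ln_le x y : 0 < x -> x <= y -> ln x <= ln y.
Proof. by move=> x0 [xy|->]; [left; apply: ln_increasing|right]. Qed.

Lemma ln_ge0 x : 1 <= x -> 0 <= ln x.
Proof. by move=> H; rewrite -ln_1; apply: ln_le; lra. Qed.

(** The case n = 0 holds because [ln] takes the value 0 off the positive reals. *)
Lemma ln_INR_ge0 n : 0 <= ln (INR n).
Proof.
case: n => [|n]; last by apply: ln_ge0; apply: INR_ge1.
by rewrite /ln; case: (Rlt_dec 0 (INR 0)) => [H|_]; [exfalso; rewrite /= in H; lra|lra].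
Qed.

Lemma ln_le_sub1 x : 0 < x -> ln x <= x - 1.
Proof. by move=> x0; have := exp_ineq1_le (ln x); rewrite exp_ln //; lra. Qed.

Lemma ln2_bounds : / 2 <= ln 2 <= 1.
Proof. by have := ln_lt_2; have := @ln_le_sub1 2; lra. Qed.

Lemma prod_primes_logn n : (0 < n)%N -> n = (\prod_(p <- primes n) p ^ logn p n)%N.
Proof. by move=> n0; rewrite {1}(prod_prime_decomp n0) prime_decompE big_map. Qed.

Lemma ln_primes n : (0 < n)%N ->
  ln (INR n) = \rsum_(p <- primes n) (INR (logn p n) * ln (INR p)).
Proof.
move=> n0; rewrite {1}(prod_primes_logn n0) INR_prod ln_rprod => [|p]; last first.
  by rewrite mem_primes => /andP[/prime_gt0 p0 _] _; apply: INR_gt0; rewrite expn_gt0 p0.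
rewrite big_seq_cond [RHS]big_seq_cond; apply: eq_bigr => p.
rewrite mem_primes andbT => /andP[/prime_gt0 p0 _].
by rewrite INR_expn ln_pow //; apply: INR_gt0.
Qed.

(** * The upper bound for d *)

Definition log2R (n : nat) : R := ln (INR n) / ln 2.

(* Vanishes at 2 and is superadditive in log2 n with a surplus of 1. *)
Definition tree_weight (n : nat) : R := (log2R n ^ 2 + log2R n) / 2 - 1.

Lemma log2R_mul a b : (0 < a)%N -> (0 < b)%N -> log2R (a * b) = log2R a + log2R b.
Proof.
move=> a0 b0; rewrite /log2R INR_muln ln_mult; try exact: INR_gt0.
by have := ln2_bounds; move=> ?; field; lra.
Qed.

Lemma log2R_le a b : (0 < a)%N -> (a <= b)%N -> log2R a <= log2R b.
Proof.
move=> a0 ab; rewrite /log2R; have L := ln2_bounds.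
apply: Rmult_le_compat_r; first by left; apply: Rinv_0_lt_compat; lra.
by apply: ln_le; [exact: INR_gt0|exact: INR_leq].
Qed.

Lemma log2R_1 : log2R 1 = 0.
Proof. by rewrite /log2R ln_1 /Rdiv Rmult_0_l. Qed.

Lemma log2R_2 : log2R 2 = 1.
Proof. by rewrite /log2R -[INR 2]/2; have L := ln2_bounds; field; lra. Qed.

Lemma log2R_ge0 a : 0 <= log2R a.
Proof.
rewrite /log2R; have L := ln2_bounds; apply: Rmult_le_pos; first exact: ln_INR_ge0.
by left; apply: Rinv_0_lt_compat; lra.
Qed.

Lemma log2R_ge1 a : (1 < a)%N -> 1 <= log2R a.
Proof. by move=> a1; rewrite -log2R_2; apply: log2R_le. Qed.

Lemma tree_weight_ge0 a : (1 < a)%N -> 0 <= tree_weight a.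
Proof. by move/log2R_ge1; rewrite /tree_weight; nra. Qed.

Lemma tree_weight_le a b : (0 < a)%N -> (a <= b)%N -> tree_weight a <= tree_weight b.
Proof.
move=> a0 /(log2R_le a0); have := log2R_ge0 a; rewrite /tree_weight; nra.
Qed.

(** For the first element x and the product P of the rest, w(x P) = w(x) + w(P) + 1 + log2 x log2 P.
    The indicator pays for the empty product, whose weight is -1. *)
Lemma sum_tree_weight (s : seq nat) : (forall p, p \in s -> (0 < p)%N) ->
  \rsum_(p <- s) tree_weight p <= tree_weight (\prod_(p <- s) p) + INR (s == [::]).
Proof.
elim: s => [|x s IH] H.
  by rewrite !big_nil eqxx /tree_weight log2R_1 /=; lra.
have x0 : (0 < x)%N by apply: H; rewrite mem_head.
have H' p : p \in s -> (0 < p)%N by move=> ps; apply: H; rewrite inE ps orbT.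
have P0 : (0 < \prod_(p <- s) p)%N by rewrite big_seq_cond; apply: prodn_cond_gt0 => p /andP[/H'].
rewrite !big_cons /=; have := IH H'.
have : INR (s == [::]) <= 1 by case: (s == [::]) => /=; lra.
rewrite /tree_weight log2R_mul //.
have := log2R_ge0 x; have := log2R_ge0 (\prod_(p <- s) p); nra.
Qed.

Lemma prod_primes_le n : (0 < n)%N -> (\prod_(p <- primes n) p <= n)%N.
Proof.
move=> n0; rewrite [X in (_ <= X)%N](prod_primes_logn n0) big_seq_cond [X in (_ <= X)%N]big_seq_cond.
apply: leq_prod => p; rewrite andbT -logn_gt0 => l0.
have p1 : prime p by move: l0; rewrite lognE; case: (prime p).
by rewrite -{1}(expn1 p) leq_exp2l // prime_gt1.
Qed.

Lemma sum_tree_weight_primes n : (1 < n)%N ->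
  \rsum_(p <- primes n) tree_weight p <= tree_weight n.
Proof.
move=> n1; have n0 : (0 < n)%N by lia.
have pos p : p \in primes n -> (0 < p)%N by rewrite mem_primes => /andP[/prime_gt0].
have := sum_tree_weight pos.
have -> : (primes n == [::]) = false.
  by apply/eqP => E; have := pdiv_prime n1; have := pi_pdiv n; rewrite /= unfold_in /= E n1.
rewrite /=; have : tree_weight (\prod_(p <- primes n) p) <= tree_weight n; last lra.
apply: tree_weight_le; last exact: prod_primes_le.
by rewrite big_seq_cond; apply: prodn_cond_gt0 => p /andP[/pos].
Qed.

(** 2^11 <= 3^7. This precision serves the prime 3: w(3) >= 1 means l^2 + l >= 4, that is l >=
    1.562, and 11/7 is 1.571. *)
Lemma log2R_3 : 11 / 7 <= log2R 3.
Proof.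
have L := ln2_bounds.
have H : ln (INR (2 ^ 11)%N) <= ln (INR (3 ^ 7)%N).
  by apply: ln_le; [exact: INR_gt0|exact: INR_leq].
move: H; rewrite !INR_expn !ln_pow; try (rewrite /=; lra).
rewrite /log2R => H; apply: (Rmult_le_reg_r (ln 2)); first lra.
rewrite /Rdiv (Rmult_assoc (ln _)) Rinv_l ?Rmult_1_r; last lra.
have [e2 e7 e11] : [/\ INR 2 = 2, INR 7 = 7 & INR 11 = 11] by split; rewrite /=; lra.
by move: H; rewrite e2 e7 e11; lra.
Qed.

(** As a function of l = log2 (q - 1) the weight satisfies w(l - 1) = w(l) - l. The prime 2 divides
    q - 1 and weighs 0, so the odd primes of q - 1 have product at most (q - 1) / 2 and, by
    superadditivity, total weight at most w(l - 1). *)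
Lemma prime_tree_weight q : prime q ->
  log2R (q - 1) + \rsum_(p <- primes (q - 1)) tree_weight p <= tree_weight q.
Proof.
move=> pq; have q1 := prime_gt1 pq.
case: (eqVneq q 2%N) => [->|q2].
  by rewrite big_nil log2R_1 /tree_weight log2R_2; lra.
have n2 : (2 %| q - 1)%N by case: (even_prime pq) => [/eqP|oq]; [rewrite (negbTE q2)|rewrite dvdn2 oddB ?oq // ltnW].
set n := (q - 1)%N in n2 *.
have n0 : (0 < n)%N by rewrite /n; lia.
have np : 2%N \in primes n by rewrite mem_primes n0.
rewrite (perm_big _ (perm_to_rem np)) big_cons /=.
have -> : tree_weight 2 = 0 by rewrite /tree_weight log2R_2; lra.
have nq : tree_weight n <= tree_weight q by apply: tree_weight_le => //; rewrite /n; lia.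
set s := rem 2%N (primes n).
have pos p : p \in s -> (0 < p)%N.
  by move/mem_rem; rewrite mem_primes => /andP[/prime_gt0].
(* Here q - 1 is a power of 2. For l >= 2 already l <= w(l); for q = 3 the gain from q - 1 to q is
   used. *)
case E : (s == [::]).
  rewrite (eqP E) big_nil.
  case: (leqP 4 n) => n4.
    have : 2 <= log2R n.
      have <- : log2R 4 = 2 by rewrite (@log2R_mul 2 2) // log2R_2; lra.
      exact: log2R_le.
    by move: nq; rewrite /tree_weight; nra.
  have n_eq : n = 2%N by move: n4 n0 n2; case: (n) => [|[|[|[|]]]].
  have -> : q = 3%N by move: n_eq; rewrite /n; lia.
  by rewrite n_eq log2R_2 /tree_weight; have := log2R_3; nra.
have P0 : (0 < \prod_(p <- s) p)%N by rewrite big_seq_cond; apply: prodn_cond_gt0 => p /andP[/pos].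
have Pn : (2 * \prod_(p <- s) p <= n)%N.
  by have := prod_primes_le n0; rewrite (perm_big _ (perm_to_rem np)) big_cons.
have := sum_tree_weight pos; rewrite E /= => Hs.
have : log2R (\prod_(p <- s) p) <= log2R n - 1.
  have : log2R (2 * \prod_(p <- s) p) <= log2R n by apply: log2R_le => //; rewrite muln_gt0.
  by rewrite log2R_mul // log2R_2; lra.
have := log2R_ge0 (\prod_(p <- s) p).
move: nq Hs; set S := \rsum_(p <- s) _; rewrite /tree_weight; move: S => S.
set a := log2R (\prod_(p <- s) p); set l := log2R n; move: a l => a l Hq Hs a0 al.
have : a ^ 2 + a <= (l - 1) ^ 2 + (l - 1) by nra.
by lra.
Qed.

Lemma totient_rad m : totient (rad m) = (\prod_(p <- primes m) (p - 1))%N.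
Proof.
have : all prime (primes m) by apply/allP => p; rewrite mem_primes => /andP[].
rewrite /rad; elim: (primes m) (primes_uniq m) => [|p s IH] /=; first by rewrite !big_nil.
case/andP => ps us /andP[pp as_]; rewrite !big_cons totient_coprime.
  by rewrite IH // totient_prime // subn1.
rewrite prime_coprime // Euclid_dvd_prod // big_has; apply/hasPn => r rs.
rewrite dvdn_prime2 //; last exact: (allP as_).
by apply/eqP => pr; rewrite pr rs in ps.
Qed.

(** If p does not divide m / d, the full power of p in m divides d, hence delta phi(rad m). The
    factor delta = 2 does no harm: it occurs when 4 divides m, and then 4 divides d, so one factor 2
    is left for phi(rad m). *)
Lemma prime_dvd_pred m p : (0 < m)%N -> p \in primes m -> ~~ (p %| m %/ d_fun m)%N ->
  exists2 q, q \in primes m & (p %| q - 1)%N.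
Proof.
move=> m0; rewrite mem_primes => /and3P[pp _ pm] pn.
have dm : (d_fun m %| m)%N by apply: dvdn_gcdl.
have dphi : (d_fun m %| delta m * totient (rad m))%N by apply: dvdn_gcdr.
suff : (p %| totient (rad m))%N.
  by rewrite totient_rad Euclid_dvd_prod // big_has => /hasP[q]; exists q.
have cop e : coprime (p ^ e) (m %/ d_fun m) by apply: coprimeXl; rewrite prime_coprime.
have dvd e : (p ^ e %| m)%N -> (p ^ e %| d_fun m)%N.
  by rewrite -{1}(divnK dm) Gauss_dvdr.
have := dvdn_trans (dvd 1%N _) dphi; rewrite expn1 => /(_ pm).
rewrite Euclid_dvdM // => /orP[|//].
rewrite /delta; case: ifP => [m4|_]; last by rewrite Euclid_dvd1.
rewrite dvdn_prime2 // => /eqP p2; have := dvdn_trans (dvd 2%N _) dphi.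
by rewrite p2 => /(_ m4); rewrite /delta m4 (@dvdn_pmul2l 2 2).
Qed.

(** The largest prime of m divides no q - 1 with q a prime of m, so it must divide m / d. *)
Lemma quotient_gt1 m : (1 < m)%N -> (1 < m %/ d_fun m)%N.
Proof.
move=> m1; have m0 : (0 < m)%N by lia.
have dm : (d_fun m %| m)%N by apply: dvdn_gcdl.
have n0 : (0 < m %/ d_fun m)%N by rewrite divn_gt0; [exact: dvdn_leq|rewrite /d_fun gcdn_gt0 m0].
have pp := max_pdiv_prime m1.
have pin : max_pdiv m \in primes m by rewrite mem_primes pp m0 max_pdiv_dvd.
apply: contraT; rewrite -leqNgt => n1.
have n_eq : (m %/ d_fun m = 1)%N by lia.
have [|q qm] := prime_dvd_pred m0 pin; first by rewrite n_eq Euclid_dvd1.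
move/dvdn_leq; have := max_pdiv_max qm; have : prime q by move: qm; rewrite mem_primes => /andP[].
by move/prime_gt1; lia.
Qed.

(* Summing [prime_tree_weight] over the primes of m, the primes that do not
   divide m / d cancel, because each of them occurs in some q - 1. *)
Lemma log2R_d_fun m : (1 < m)%N ->
  log2R (d_fun m) <= 1 + tree_weight (m %/ d_fun m).
Proof.
move=> m1; have m0 : (0 < m)%N by lia.
set n := (m %/ d_fun m)%N; have n1 : (1 < n)%N := quotient_gt1 m1.
have pr p k : p \in primes k -> prime p by rewrite mem_primes => /andP[].
have w0 p k : p \in primes k -> 0 <= tree_weight p by move/pr/prime_gt1/tree_weight_ge0.
have d_le : log2R (d_fun m) <= 1 + \rsum_(q <- primes m) log2R (q - 1).
  have d0 : (0 < d_fun m)%N by rewrite /d_fun gcdn_gt0 m0.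
  have t0 : (0 < totient (rad m))%N.
    rewrite totient_gt0 /rad big_seq_cond; apply: prodn_cond_gt0 => p /andP[/pr].
    by move/prime_gt0.
  have -> : \rsum_(q <- primes m) log2R (q - 1) = log2R (totient (rad m)).
    rewrite totient_rad /log2R INR_prod ln_rprod => [|p /pr/prime_gt1 p1 _]; last first.
      by apply: INR_gt0; lia.
    by rewrite /Rdiv big_distrl.
  have := @log2R_mul 2 _ isT t0; rewrite log2R_2 => <-; apply: log2R_le => //.
  apply: (@leq_trans (delta m * totient (rad m))); last first.
    by rewrite leq_mul2r /delta; case: ifP; rewrite orbT.
  by apply: dvdn_leq; [rewrite muln_gt0 t0 andbT /delta; case: ifP|exact: dvdn_gcdr].
have H1 : \rsum_(q <- primes m) log2R (q - 1) +
    \rsum_(q <- primes m) \rsum_(p <- primes (q - 1)) tree_weight p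
    <= \rsum_(q <- primes m) tree_weight q.
  by rewrite -big_split /=; apply: rsum_le => q /pr qm _; apply: prime_tree_weight.
have H2 : \rsum_(p <- primes m | ~~ (p %| n)%N) tree_weight p
    <= \rsum_(q <- primes m) \rsum_(p <- primes (q - 1)) tree_weight p.
  rewrite -(big_map (fun q => primes (q - 1)) xpredT (fun s => \rsum_(p <- s) tree_weight p)).
  rewrite -big_flatten -big_filter; apply: rsum_subset.
  - by rewrite filter_uniq // primes_uniq.
  - move=> p; rewrite mem_filter => /andP[pn pm].
    have [q qm pq] := prime_dvd_pred m0 pm pn.
    apply/flatten_mapP; exists q => //.
    by rewrite mem_primes (pr _ _ pm) pq /= andbT subn_gt0 prime_gt1 // (pr _ _ qm).
  - by move=> p /flatten_mapP[q _]; apply: w0.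
have H3 : \rsum_(p <- primes m | (p %| n)%N) tree_weight p <= tree_weight n.
  apply: Rle_trans (sum_tree_weight_primes n1).
  rewrite -big_filter; apply: rsum_subset.
  - by rewrite filter_uniq // primes_uniq.
  - move=> p; rewrite mem_filter => /andP[pn pm].
    by rewrite mem_primes (pr _ _ pm) pn /= andbT; lia.
  - by move=> p; apply: w0.
by move: H1; rewrite [X in _ <= X](bigID (fun p => p %| n)%N) /=; lra.
Qed.

Lemma d_fun_upper_bound m : (1 <= m)%N ->
  INR (d_fun m) <= sqrt 2 * INR m * exp (- sqrt (ln 2 * ln (INR m) + ln 2 ^ 2 / 4)).
Proof.
move=> m0; have L := ln2_bounds.
have dm : (d_fun m %| m)%N by apply: dvdn_gcdl.
set n := (m %/ d_fun m)%N.
have n0 : (0 < n)%N by rewrite divn_gt0; [exact: dvdn_leq|rewrite /d_fun gcdn_gt0 m0].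
have d0 : (0 < d_fun m)%N by rewrite /d_fun gcdn_gt0 m0.
have mE : m = (n * d_fun m)%N by rewrite divnK.
(* With x = log2 n the weight bound reads log2 m <= (x^2 + 3 x) / 2, and n > 1 gives x <= x^2. *)
have key : log2R m <= log2R n ^ 2 + log2R n.
  case: (leqP m 1) => [m1|m1].
    have -> : m = 1%N by lia.
    by rewrite log2R_1; have := log2R_ge0 n; nra.
  have := log2R_d_fun m1; have := log2R_ge1 (quotient_gt1 m1); rewrite -/n.
  by rewrite [in log2R m]mE log2R_mul // /tree_weight; nra.
have lnE k : ln (INR k) = ln 2 * log2R k by rewrite /log2R; field; lra.
have x0 := log2R_ge0 n.
(* The square of the right side is (ln 2)^2 (x^2 + x + 1/4). *)
have H : sqrt (ln 2 * ln (INR m) + ln 2 ^ 2 / 4) <= ln 2 / 2 + ln (INR n).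
  rewrite -[X in _ <= X]sqrt_Rsqr; last by rewrite lnE; nra.
  by apply: sqrt_le_1_alt; rewrite /Rsqr !lnE; nra.
have d_eq : INR (d_fun m) = INR m * exp (- ln (INR n)).
  rewrite exp_Ropp exp_ln; last exact: INR_gt0.
  by rewrite {2}mE INR_muln; field; apply: Rgt_not_eq; apply: INR_gt0.
have -> : sqrt 2 = exp (ln 2 / 2) by rewrite -/(ln 2 / 2) -Rpower_sqrt ?/Rpower; [congr exp; field|lra].
rewrite d_eq (Rmult_comm (exp _)) Rmult_assoc -exp_plus.
apply: Rmult_le_compat_l; first exact: pos_INR.
have [H'|->] : - ln (INR n) <= ln 2 / 2 + - sqrt (ln 2 * ln (INR m) + ln 2 ^ 2 / 4) by lra.
  by left; apply: exp_increasing.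
by right.
Qed.

(** * Chebyshev and Mertens estimates *)

Lemma rsum_le_map (I J : eqType) (s : seq I) (t : seq J) (P : pred I) (Q : pred J)
    (g : J -> I) (F : I -> R) :
  uniq s -> (forall i, i \in s -> P i -> exists2 j, (j \in t) && Q j & i = g j) ->
  (forall j, j \in t -> Q j -> 0 <= F (g j)) ->
  \rsum_(i <- s | P i) F i <= \rsum_(j <- t | Q j) F (g j).
Proof.
move=> us H F0; rewrite -big_filter -[X in _ <= X]big_filter -(big_map g xpredT F).
apply: rsum_subset; first exact: filter_uniq.
  move=> i; rewrite mem_filter => /andP[Pi si].
  have [j /andP[jt Qj] ->] := H i si Pi; apply: map_f; by rewrite mem_filter Qj.
by move=> i /mapP[j]; rewrite mem_filter => /andP[Qj jt] ->; apply: F0.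
Qed.

Lemma rsum_multiples N d (F : nat -> R) : (0 < d)%N -> (forall n, 0 <= F n) ->
  \rsum_(n <- iota 1 N | (d %| n)%N) F n <= \rsum_(a <- iota 1 N) F (d * a)%N.
Proof.
move=> d0 F0; apply: rsum_le_map; first exact: iota_uniq.
  move=> n; rewrite mem_iota => nN /dvdnP[a an]; exists a; last by rewrite an mulnC.
  by rewrite mem_iota andbT; nia.
by move=> a _ _.
Qed.

Lemma ln_succ n : (0 < n)%N -> / INR n.+1 <= ln (INR n.+1) - ln (INR n) <= / INR n.
Proof.
move=> n0; have n0' := INR_gt0 n0; have e := S_INR n.
have n1 : 0 < INR n.+1 by rewrite e; lra.
split.
  have : ln (INR n * / INR n.+1) <= INR n * / INR n.+1 - 1.
    by apply: ln_le_sub1; apply: Rmult_lt_0_compat => //; apply: Rinv_0_lt_compat.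
  rewrite ln_mult ?ln_Rinv //; last exact: Rinv_0_lt_compat.
  have -> : INR n * / INR n.+1 - 1 = - / INR n.+1 by rewrite e; field; lra.
  by lra.
have : ln (INR n.+1 * / INR n) <= INR n.+1 * / INR n - 1.
  by apply: ln_le_sub1; apply: Rmult_lt_0_compat => //; apply: Rinv_0_lt_compat.
rewrite ln_mult ?ln_Rinv //; last exact: Rinv_0_lt_compat.
have -> : INR n.+1 * / INR n - 1 = / INR n by rewrite e; field; lra.
by lra.
Qed.

Lemma ln_exp2 h : ln (INR (2 ^ h)) = INR h * ln 2.
Proof. by rewrite INR_expn ln_pow //=; lra. Qed.

Definition harmonic N := \rsum_(a <- iota 1 N) / INR a.

Lemma harmonicS N : harmonic N.+1 = harmonic N + / INR N.+1.
Proof. by rewrite /harmonic -{1}(addn1 N) iotaD big_cat big_seq1 add1n. Qed.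

Lemma harmonic_bounds N : ln (INR N.+1) <= harmonic N /\ ((0 < N)%N -> harmonic N <= 1 + ln (INR N)).
Proof.
elim: N => [|N [IH1 IH2]]; first by split=> //; rewrite /harmonic big_nil ln_1; lra.
rewrite harmonicS; split; first by have := @ln_succ N.+1 isT; lra.
move=> _; case: N {IH1} IH2 => [_|N IH2]; first by rewrite /harmonic big_nil ln_1 /=; lra.
by have := IH2 isT; have := @ln_succ N.+1 isT; lra.
Qed.

Lemma harmonic_ge0 N : 0 <= harmonic N.
Proof. by have [] := harmonic_bounds N; have := ln_INR_ge0 N.+1; lra. Qed.

Definition primes_le z := [seq p <- iota 0 z.+1 | prime p].

Lemma mem_primes_le p z : (p \in primes_le z) = prime p && (p <= z)%N.
Proof. by rewrite mem_filter mem_iota. Qed.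

Lemma primes_le_uniq z : uniq (primes_le z).
Proof. by rewrite filter_uniq // iota_uniq. Qed.

Lemma primes_leD a b : primes_le (a + b) = primes_le a ++ [seq p <- iota a.+1 b | prime p].
Proof. by rewrite /primes_le -addSn iotaD filter_cat. Qed.

Lemma prod_primes_dvd (s : seq nat) N : uniq s -> all prime s ->
  (forall p, p \in s -> (p %| N)%N) -> (\prod_(p <- s) p %| N)%N.
Proof.
elim: s => [|p s IH] /=; first by rewrite big_nil dvd1n.
case/andP => ps us /andP[pp als] H; rewrite big_cons Gauss_dvd.
  by rewrite H ?mem_head // IH // => q qs; rewrite H // inE qs orbT.
rewrite prime_coprime // Euclid_dvd_prod // big_has; apply/hasPn => r rs.
rewrite dvdn_prime2 //; last exact: (allP als).
by apply/eqP => pr; rewrite pr rs in ps.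
Qed.

Lemma bin_le_exp2 n m : ('C(n, m) <= 2 ^ n)%N.
Proof.
case: (leqP m n) => mn; last by rewrite bin_small.
rewrite (_ : 2 ^ n = \sum_(i < n.+1) 'C(n, i))%N; last first.
  by rewrite -[2%N]/(1 + 1)%N expnDn; apply: eq_bigr => i _; rewrite !exp1n !muln1.
by rewrite (bigD1 (inord m)) //= inordK ?ltnS // leq_addr.
Qed.

Lemma exp_size_le_prod (s : seq nat) (F : nat -> nat) n :
  (forall p, p \in s -> (n <= F p)%N) -> (n ^ size s <= \prod_(p <- s) F p)%N.
Proof.
elim: s => [|p s IH] H; first by rewrite big_nil.
rewrite big_cons expnS leq_mul ?H ?mem_head // IH // => q qs.
by rewrite H // inE qs orbT.
Qed.

Lemma prod_le_exp_size (s : seq nat) (F : nat -> nat) n :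
  (forall p, p \in s -> (F p <= n)%N) -> (\prod_(p <- s) F p <= n ^ size s)%N.
Proof.
elim: s => [|p s IH] H; first by rewrite big_nil.
rewrite big_cons expnS leq_mul ?H ?mem_head // IH // => q qs.
by rewrite H // inE qs orbT.
Qed.

(** Chebyshev's argument: the primes in (n, 2n] all divide C(2n, n) <= 4^n, here with n = 2^i. *)
Lemma size_prime_block i : (i * size [seq p <- iota (2 ^ i).+1 (2 ^ i) | prime p] <= 2 * 2 ^ i)%N.
Proof.
set n := (2 ^ i)%N; set s := [seq _ <- _ | _].
have dvd : (\prod_(p <- s) p %| 'C(n + n, n))%N.
  apply: prod_primes_dvd; first by rewrite filter_uniq // iota_uniq.
    by apply/allP => p; rewrite mem_filter => /andP[].
  move=> p; rewrite mem_filter mem_iota => /and3P[pp np pn].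
  have : (p %| (n + n)`!)%N by rewrite dvdn_fact //; lia.
  rewrite -(@bin_fact (n + n) n) ?leq_addr // addnK !Euclid_dvdM //.
  have -> : (p %| n`!)%N = false.
    apply/negP; rewrite fact_prod Euclid_dvd_prod // big_has => /hasP[k].
    by rewrite mem_index_iota => /andP[k0 kn] /dvdn_leq; lia.
  by rewrite !orbF.
have : (n ^ size s <= 2 ^ (n + n))%N.
  apply: leq_trans (bin_le_exp2 _ n); apply: leq_trans (dvdn_leq _ dvd); last first.
    by rewrite bin_gt0 leq_addr.
  apply: exp_size_le_prod => p; rewrite mem_filter mem_iota => /and3P[_ np _]; lia.
by rewrite -expnM leq_exp2l // addnn -mul2n.
Qed.

(** Each term is at most c / 2^i, against Chebyshev's count of the block. Taking c = 1 and c = ln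
    2^(i+1) yields the two Mertens sums below. *)
Lemma sum_prime_block (F : nat -> R) i c : (0 < i)%N ->
  (forall p, (2 ^ i < p <= 2 ^ i.+1)%N -> F p <= c) -> 0 <= c ->
  \rsum_(p <- [seq p <- iota (2 ^ i).+1 (2 ^ i) | prime p]) (F p / INR p) <= 2 * c / INR i.
Proof.
move=> i0 H c0; have i0' := INR_gt0 i0.
have n0 : 0 < INR (2 ^ i) by apply: INR_gt0; rewrite expn_gt0.
apply: (@Rle_trans _ (\rsum_(p <- [seq p <- iota (2 ^ i).+1 (2 ^ i) | prime p]) (c / INR (2 ^ i)))).
  apply: rsum_le => p; rewrite mem_filter mem_iota => /and3P[pp np pn] _.
  have := H p; rewrite np expnS mul2n -addnn -ltnS -addSn pn => /(_ isT) Fp.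
  have p0 : 0 < INR p by apply: INR_gt0; lia.
  apply: (@Rle_trans _ (c / INR p)).
    by apply: Rmult_le_compat_r => //; left; apply: Rinv_0_lt_compat.
  apply: Rmult_le_compat_l => //; apply: Rinv_le_contravar => //.
  by apply: INR_leq; lia.
rewrite rsum_const; have := INR_leq (size_prime_block i); rewrite !INR_muln.
set S := INR (size _); rewrite -[INR 2]/2 => HS.
apply: (Rmult_le_reg_r (INR i * INR (2 ^ i))); first exact: Rmult_lt_0_compat.
have -> : S * (c / INR (2 ^ i)) * (INR i * INR (2 ^ i)) = (INR i * S) * c by field; lra.
have -> : 2 * c / INR i * (INR i * INR (2 ^ i)) = (2 * INR (2 ^ i)) * c by field; lra.
by apply: Rmult_le_compat_r.
Qed.

Lemma primes_le_exp2S i : primes_le (2 ^ i.+1) =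
  primes_le (2 ^ i) ++ [seq p <- iota (2 ^ i).+1 (2 ^ i) | prime p].
Proof. by rewrite expnS mul2n -addnn primes_leD. Qed.

Lemma sum_inv_primes h : (0 < h)%N ->
  \rsum_(p <- primes_le (2 ^ h)) / INR p <= 3 + 2 * ln (INR h).
Proof.
have step i : (0 < i)%N -> \rsum_(p <- primes_le (2 ^ i.+1)) / INR p <=
    \rsum_(p <- primes_le (2 ^ i)) / INR p + 2 / INR i.
  move=> i0; rewrite primes_le_exp2S big_cat; apply: Rplus_le_compat_l.
  have := @sum_prime_block (fun=> 1) i 1 i0; rewrite Rmult_1_r => H.
  under eq_bigr => p _ do rewrite -[/ INR p]Rmult_1_l.
  by apply: H; [move=> *; lra|lra].
have base : \rsum_(p <- primes_le (2 ^ 1)) / INR p <= 1.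
  by rewrite big_seq1 /=; lra.
have H n : \rsum_(p <- primes_le (2 ^ n.+2)) / INR p <= 3 + 2 * ln (INR n.+1).
  elim: n => [|n IH]; first by have := step 1%N isT; rewrite ln_1 -[INR 1]/1; lra.
  by have := step n.+2 isT; have := @ln_succ n.+1 isT; rewrite /Rdiv; lra.
case: h => [//|[|h]] _; first by rewrite ln_1; lra.
by have := H h; have := @ln_le (INR h.+1) (INR h.+2) (@INR_gt0 h.+1 isT) (INR_leq (leqnSn _)); lra.
Qed.

Lemma sum_ln_primes h : \rsum_(p <- primes_le (2 ^ h)) (ln (INR p) / INR p) <= 4 * (INR h * ln 2).
Proof.
have L := ln2_bounds.
elim: h => [|h IH]; first by rewrite big_nil; rewrite /=; lra.
rewrite primes_le_exp2S big_cat S_INR.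
suff : \rsum_(p <- [seq p <- iota (2 ^ h).+1 (2 ^ h) | prime p]) (ln (INR p) / INR p) <= 4 * ln 2.
  by rewrite /=; lra.
case: h {IH} => [|h]; first by rewrite big_seq1 -[INR 2]/2; lra.
have h0 : 1 <= INR h.+1 by apply: INR_ge1.
apply: (@Rle_trans _ (2 * (INR h.+2 * ln 2) / INR h.+1)).
  apply: sum_prime_block => //; last by have := pos_INR h.+2; nra.
  move=> p /andP[p1 p2]; rewrite -ln_exp2; apply: ln_le; [by apply: INR_gt0; lia|exact: INR_leq].
rewrite S_INR; apply: (Rmult_le_reg_r (INR h.+1)); first lra.
have -> : 2 * ((INR h.+1 + 1) * ln 2) / INR h.+1 * INR h.+1 = 2 * ((INR h.+1 + 1) * ln 2) by field; lra.
by nra.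
Qed.

Lemma bin2n_ge n : (2 ^ n <= 'C(n + n, n))%N.
Proof.
elim: n => [//|n IH]; rewrite addSn addnS.
have := mul_bin_diag (n + n).+2 n; rewrite /= => E.
have : ('C(n + n, n) <= 'C((n + n).+1, n))%N.
  by case: (n) => [//|k]; rewrite binS leq_addr.
by rewrite expnS; nia.
Qed.

(** By Legendre's formula v is a sum of terms floor(2n / p^k) - 2 floor(n / p^k), each at most 1 and
    zero once p^k > 2n. If p^v exceeded 2n, only the exponents k < v could contribute, giving v <= v
    - 1. *)
Lemma exp_logn_bin p n : prime p -> (0 < n)%N -> (p ^ logn p 'C(n + n, n) <= n + n)%N.
Proof.
move=> pp n0; set v := logn p _; rewrite leqNgt; apply/negP => big.
have v0 : (0 < v)%N by rewrite lt0n; apply/eqP => v0; rewrite v0 in big; lia.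
have E : (\sum_(1 <= k < (n + n).+1) (n + n) %/ p ^ k =
    v + (\sum_(1 <= k < (n + n).+1) n %/ p ^ k + \sum_(1 <= k < (n + n).+1) n %/ p ^ k))%N.
  have ext : (\sum_(1 <= k < (n + n).+1) n %/ p ^ k = logn p n`!)%N.
    rewrite logn_fact // (@big_cat_nat _ _ _ n.+1) //=; last lia.
    rewrite big_nat_cond [X in (_ + X = _)%N]big_nat_cond [X in (_ + X = _)%N]big1 ?addn0 -?big_nat_cond // => k /andP[/andP[nk _] _].
    by apply: divn_small; apply: leq_trans (ltn_expl _ (prime_gt1 pp)); lia.
  rewrite ext -logn_fact // -(@bin_fact (n + n) n) ?leq_addr // addnK.
  by rewrite !lognM ?fact_gt0 ?muln_gt0 ?fact_gt0 ?bin_gt0 ?leq_addr.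
have : (v <= \sum_(1 <= k < (n + n).+1) (k < v))%N.
  suff : (\sum_(1 <= k < (n + n).+1) (n + n) %/ p ^ k <= \sum_(1 <= k < (n + n).+1) (k < v) +
      (\sum_(1 <= k < (n + n).+1) n %/ p ^ k + \sum_(1 <= k < (n + n).+1) n %/ p ^ k))%N by lia.
  rewrite -!big_split; apply: leq_sum => k _ /=.
  case: (leqP v k) => vk /=.
    rewrite divn_small //; apply: leq_trans big _; rewrite leq_exp2l //; exact: prime_gt1.
  have pk : (0 < p ^ k)%N by rewrite expn_gt0 prime_gt0.
  have := ltn_ceil n pk; have := leq_trunc_div (n + n) (p ^ k); nia.
have -> : (\sum_(1 <= k < (n + n).+1) (k < v) = minn (n + n) v.-1)%N; last lia.
elim: (n + n)%N => [|M IH]; first by rewrite big_nil min0n.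
by rewrite big_nat_recr //= IH; case: leqP; lia.
Qed.

(** Chebyshev's lower bound: 2^n <= C(2n, n), and each prime power in C(2n, n) is at most 2n, so
    (2n)^(pi(2n)) >= 2^n with n = 2^i. *)
Lemma size_primes_le i : (2 ^ i <= i.+1 * size (primes_le (2 ^ i.+1)))%N.
Proof.
set n := (2 ^ i)%N; have n0 : (0 < n)%N by rewrite expn_gt0.
have nn : (2 ^ i.+1 = n + n)%N by rewrite expnS mul2n addnn.
have C0 : (0 < 'C(n + n, n))%N by rewrite bin_gt0 leq_addr.
have : (2 ^ n <= (n + n) ^ size (primes_le (n + n)))%N.
  apply: leq_trans (bin2n_ge n) _; rewrite {1}(prod_primes_logn C0).
  apply: (@leq_trans ((n + n) ^ size (primes 'C(n + n, n)))).
    by apply: prod_le_exp_size => p; rewrite mem_primes => /andP[pp _]; apply: exp_logn_bin.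
  rewrite leq_pexp2l ?addn_gt0 ?n0 // uniq_leq_size ?primes_uniq // => p.
  rewrite mem_primes mem_primes_le => /and3P[pp _ dv]; rewrite pp /=.
  apply: leq_trans (exp_logn_bin pp n0).
  rewrite -{1}(expn1 p) leq_exp2l ?prime_gt1 // logn_gt0 mem_primes pp C0 //.
by rewrite -nn -expnM leq_exp2l.
Qed.

(** Euler's product, kept finite. Splitting off the multiples of p gives f(p, ps) <= f(ps) + f(p,
    ps) / p, and truncation at N only helps. *)
Lemma smooth_sum_prod (ps : seq nat) N : all prime ps ->
  (\rsum_(n <- iota 1 N | all (mem ps) (primes n)) / INR n) *
  \rprod_(p <- ps) (1 - / INR p) <= 1.
Proof.
elim: ps => [|p ps IH] /=.
  move=> _; rewrite big_nil Rmult_1_r.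
  apply: (@Rle_trans _ (\rsum_(n <- [:: 1%N]) / INR n)); last by rewrite big_seq1 /=; lra.
  rewrite -big_filter; apply: rsum_subset; first by rewrite filter_uniq // iota_uniq.
    move=> n; rewrite mem_filter mem_iota inE => /and3P[H n0 _].
    case: (leqP n 1) => [|n1]; first by lia.
    have := allP H (pdiv n); rewrite mem_primes pdiv_prime // n0 pdiv_dvd => /(_ isT).
    by rewrite inE.
  by move=> n; rewrite inE => /eqP ->; rewrite /=; lra.
case/andP => pp aps; have {IH} := IH aps.
pose f (qs : seq nat) := \rsum_(n <- iota 1 N | all (mem qs) (primes n)) / INR n.
rewrite -/(f ps) -/(f (p :: ps)) big_cons; set Q := \rprod_(q <- ps) _ => IH.
have p2 := INR_prime_ge2 pp.
have ip : 0 < / INR p <= / 2 by split; [apply: Rinv_0_lt_compat|apply: Rinv_le_contravar]; lra.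
have Q0 : 0 <= Q.
  apply: rprod_ge0 => q qs _; have := INR_prime_ge2 (allP aps q qs) => q2.
  by have : / INR q <= / 2; [apply: Rinv_le_contravar|]; lra.
suff H : f (p :: ps) <= f ps + / INR p * f (p :: ps) by nra.
rewrite {1}/f (bigID (fun n => p %| n)%N) /= Rplus_comm; apply: Rplus_le_compat.
  rewrite -big_filter -[X in _ <= X]big_filter; apply: rsum_subset.
  - by rewrite filter_uniq // iota_uniq.
  - move=> n; rewrite !mem_filter => /andP[/andP[H pn] ni]; rewrite ni andbT.
    apply/allP => q qn; have := allP H q qn; rewrite inE => /orP[/eqP qp|//].
    by move: qn pn; rewrite mem_primes qp => /and3P[_ _ ->].
  - by move=> n _; have := pos_INR n; case: (n) => [|k] _; [rewrite /= Rinv_0; lra|left; apply: Rinv_0_lt_compat; apply: INR_gt0].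
rewrite /f -rsum_mull.
apply: (@Rle_trans _ (\rsum_(a <- iota 1 N | all (mem (p :: ps)) (primes a)) / INR (p * a))).
  apply: (@rsum_le_map _ _ _ _ _ _ (fun a => p * a)%N (fun n => / INR n)); first exact: iota_uniq.
    move=> n; rewrite mem_iota => nN /andP[H /dvdnP[a an]]; exists a; last by rewrite an mulnC.
    have a0 : (0 < a)%N by lia.
    rewrite mem_iota; apply/andP; split; first by have := prime_gt1 pp; nia.
    by apply/allP => q qa; apply: (allP H); rewrite an primesM ?qa // prime_gt0.
  by move=> a; rewrite mem_iota => aN _; left; apply: Rinv_0_lt_compat; apply: INR_gt0; rewrite muln_gt0 prime_gt0 //; lia.
apply: rsum_le => a; rewrite mem_iota => aN _; rewrite INR_muln Rinv_mult; lra.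
Qed.

(** Every n <= 2^h is a product of primes up to 2^h, so the smooth sum is the full harmonic sum, at
    least ln 2^h. *)
Lemma prod_primes_le_ln h : (0 < h)%N ->
  \rprod_(p <- primes_le (2 ^ h)) (1 - / INR p) <= / (INR h * ln 2).
Proof.
move=> h0; have L := ln2_bounds; have h0' := INR_ge1 h0.
have apl : all prime (primes_le (2 ^ h)) by apply/allP => p; rewrite mem_primes_le => /andP[].
have := smooth_sum_prod (2 ^ h) apl; set Q := \rprod_(p <- _) _.
have -> : \rsum_(n <- iota 1 (2 ^ h) | all (mem (primes_le (2 ^ h))) (primes n)) / INR n
    = harmonic (2 ^ h).
  rewrite /harmonic big_seq_cond [RHS]big_seq; apply: eq_bigl => n.
  case E: (n \in iota 1 (2 ^ h)) => //=; apply/allP => p.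
  rewrite mem_primes => /and3P[pp n0 /(dvdn_leq n0) pn]; rewrite /= mem_primes_le pp /=.
  by move: E; rewrite mem_iota; lia.
have Q0 : 0 <= Q.
  apply: rprod_ge0 => q; rewrite mem_primes_le => /andP[/INR_prime_ge2 q2 _] _.
  by have : / INR q <= / 2; [apply: Rinv_le_contravar|]; lra.
have : INR h * ln 2 <= harmonic (2 ^ h).
  have [H _] := harmonic_bounds (2 ^ h); apply: Rle_trans H.
  rewrite -ln_exp2; apply: ln_le; [by apply: INR_gt0; rewrite expn_gt0|exact: INR_leq].
move=> H1 H2; apply: (Rmult_le_reg_l (INR h * ln 2)); first nra.
by rewrite Rinv_r; nra.
Qed.

(** * Brun's pure sieve in arithmetic progressions *)

Lemma count_residue d a q r : (a < d)%N -> (r <= d)%N ->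
  count (fun b => b %% d == a)%N (iota 0 (q * d + r)) = (q + (a < r))%N.
Proof.
move=> ad rd; have d0 : (0 < d)%N by lia.
have win k w : (w <= d)%N -> count (fun b => b %% d == a)%N (iota (k * d) w) = (a < w)%N.
  move=> wd; rewrite -[(k * d)%N]addn0 iotaDl count_map.
  rewrite (@eq_in_count _ _ (pred1 a)) => [|b /=]; last first.
    by rewrite mem_iota => bw; rewrite modnMDl modn_small //; lia.
  by rewrite count_uniq_mem ?iota_uniq // mem_iota.
rewrite iotaD count_cat add0n win //; congr addn.
elim: q => [//|q IH]; rewrite mulSn addnC iotaD count_cat IH add0n win // ad; lia.
Qed.

(** As m is invertible modulo d, the condition selects a single residue class of b. *)
Lemma count_dvd_progression m d B : (0 < d)%N -> coprime m d ->
  Rabs (INR (count (fun b => d %| m * b + 1)%N (iota 1 B)) - INR B / INR d) <= 1.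
Proof.
move=> d0 md; have [a ad] := @Bezoutl d m d0.
have -> : gcdn d m = 1%N by apply/eqP; rewrite -/(coprime d m) coprime_sym.
move=> da.
have E b : (d %| m * b + 1)%N = (b %% d == a)%N.
  have dE x : (d %| m * x + 1)%N = (m * x == m * a %[mod d])%N.
    rewrite -(eqn_modDr 1); rewrite /dvdn.
    by have /eqP -> : ((m * a + 1) %% d == 0)%N by move: da; rewrite addnC mulnC.
  rewrite dE; apply/eqP/eqP => [|ba]; last by rewrite -modnMmr ba.
  have H x y : (x <= y)%N -> (m * x = m * y %[mod d])%N -> (x = y %[mod d])%N.
    move=> xy /eqP; rewrite eq_sym eqn_mod_dvd ?leq_mul2l ?xy ?orbT // -mulnBr Gauss_dvdr; last by rewrite coprime_sym.
    by rewrite -eqn_mod_dvd // eq_sym => /eqP.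
  move=> mba; rewrite -(modn_small ad); case: (leqP b a) => ab; first exact: H.
  by apply/esym/(H _ _ (ltnW ab))/esym.
rewrite (eq_count E).
(* [count_residue] counts from 0, so [iota 1 B] is read off the first B + 1 naturals, with b = 0
   taken out. *)
set c := count _ _; set q := (B.+1 %/ d)%N; set r := (B.+1 %% d)%N.
have BE : (q * d + r = B.+1)%N by rewrite -divn_eq.
have rd : (r < d)%N by rewrite ltn_mod.
have := count_residue q ad (ltnW rd); rewrite BE /= -/c mod0n => cE.
have H1 : (d * c <= B + d)%N by move: cE; case: (0 =P a)%N; case: (ltnP a r) => /=; nia.
have H2 : (B <= d * c + d)%N by move: cE; case: (0 =P a)%N; case: (ltnP a r) => /=; nia.
have d0' := INR_gt0 d0.
move: (INR_leq H1) (INR_leq H2); rewrite !INR_addn INR_muln => H1' H2'.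
have -> : INR c - INR B / INR d = (INR d * INR c - INR B) / INR d by field; lra.
have iv : / INR d * INR d = 1 by field; lra.
have iv0 : 0 < / INR d by apply: Rinv_0_lt_compat.
apply: Rabs_le; rewrite /Rdiv; split; nra.
Qed.

Definition brun_count B m d (ps : seq nat) :=
  count (fun b => (d %| m * b + 1) && all (fun p => ~~ (p %| m * b + 1)) ps)%N (iota 1 B).

(** The elementary symmetric polynomial of degree t in the 1/p; it measures the cost of stopping
    Buchstab's identity after t sieving primes. *)
Fixpoint brun_err (ps : seq nat) (t : nat) : R :=
  match t, ps with
  | 0%N, _ => 1
  | _, [::] => 0
  | t'.+1, p :: ps' => brun_err ps' t'.+1 + brun_err ps' t' / INR p
  end.

(** The sum of the binomials C(size ps, i) over i <= t: the number of moduli at which the iteration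
    stops, each with a rounding error of 1. *)
Fixpoint brun_terms (ps : seq nat) (t : nat) : R :=
  match t, ps with
  | 0%N, _ => 1
  | _, [::] => 1
  | t'.+1, _ :: ps' => brun_terms ps' t'.+1 + brun_terms ps' t'
  end.

Lemma brun_count_cons B m d p ps : coprime d p ->
  brun_count B m d ps = (brun_count B m d (p :: ps) + brun_count B m (d * p) ps)%N.
Proof.
move=> dp; rewrite /brun_count; elim: (iota 1 B) => [//|b s IH] /=.
rewrite IH Gauss_dvd //; case: (d %| _)%N => //=; case: (p %| _)%N => /=; case: (all _ _) => /=; lia.
Qed.

(* Buchstab's identity, iterated t times. Keeping a two-sided bound makes the parity
   of t irrelevant. *)
Lemma brun_sieve B m ps t d : uniq ps -> all prime ps -> all (fun p => coprime m p) ps ->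
  all (fun p => coprime d p) ps -> (0 < d)%N -> coprime m d ->
  Rabs (INR (brun_count B m d ps) - INR B / INR d * \rprod_(p <- ps) (1 - / INR p))
  <= INR B / INR d * brun_err ps t + brun_terms ps t.
Proof.
elim: ps t d => [|p ps IH] t d.
  move=> _ _ _ _ d0 md; rewrite big_nil Rmult_1_r /brun_count.
  under eq_count => b do rewrite andbT.
  have := count_dvd_progression B d0 md.
  have : 0 <= INR B / INR d by apply: Rmult_le_pos; [exact: pos_INR|left; apply: Rinv_0_lt_compat; exact: INR_gt0].
  by case: t => [|t] /=; lra.
case/andP => pps ups /andP[pp aps] /andP[mp amps] /andP[dp adps] d0 md.
have p0 := prime_gt0 pp.
have Bd : 0 <= INR B / INR d by apply: Rmult_le_pos; [exact: pos_INR|left; apply: Rinv_0_lt_compat; exact: INR_gt0].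
case: t => [|t].
  (* With no step left, the count and the main term both lie between 0 and B / d + 1. *)
  have Q1 : 0 <= \rprod_(q <- p :: ps) (1 - / INR q) <= 1.
    apply: rprod_le1 => q qs _; have apps : all prime (p :: ps) by apply/andP.
    have q2 := INR_prime_ge2 (allP apps q qs); have := Rinv_0_lt_compat (INR q).
    by have : / INR q <= / 2; [apply: Rinv_le_contravar|]; lra.
  have := count_dvd_progression B d0 md.
  have : INR (brun_count B m d (p :: ps)) <= INR (count (fun b => d %| m * b + 1)%N (iota 1 B)).
    by apply: INR_leq; apply: sub_count => b /andP[].
  have := pos_INR (brun_count B m d (p :: ps)).
  set x := INR (brun_count _ _ _ _); set y := INR (count _ _); set Q := \rprod_(q <- _) _ in Q1 *.
  rewrite [brun_err _ _]/= [brun_terms _ _]/= => x0 xy H.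
  have {}H : y - INR B / INR d <= 1 by apply: Rle_trans (Rle_abs _) H.
  by apply: Rabs_le; nra.
have adps' : all (fun q => coprime (d * p) q) ps.
  apply/allP => q qs; rewrite coprimeMl (allP adps q qs) /= prime_coprime // dvdn_prime2 //; last exact: (allP aps).
  by apply/eqP => pq; rewrite pq qs in pps.
have := IH t.+1 d ups aps amps adps d0 md.
have := IH t (d * p)%N ups aps amps adps'; rewrite muln_gt0 d0 p0 coprimeMr md mp => /(_ isT isT).
rewrite (brun_count_cons B m ps dp) INR_addn big_cons INR_muln.
set Q := \rprod_(q <- _) _; set x := INR (brun_count _ _ _ (p :: _)); set y := INR (brun_count _ _ _ _).
have -> : INR B / (INR d * INR p) = INR B / INR d * / INR p.
  by have := INR_gt0 d0; have := INR_gt0 p0; move=> ? ?; field; lra.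
move=> H1 H2.
have -> : x - INR B / INR d * ((1 - / INR p) * Q) =
  (x + y - INR B / INR d * Q) - (y - INR B / INR d * / INR p * Q) by ring.
apply: Rle_trans (Rabs_triang _ _) _; rewrite Rabs_Ropp.
have -> : brun_err (p :: ps) t.+1 = brun_err ps t.+1 + brun_err ps t / INR p by [].
have -> : brun_terms (p :: ps) t.+1 = brun_terms ps t.+1 + brun_terms ps t by [].
by rewrite /Rdiv in H1 H2 *; lra.
Qed.

Lemma brun_err_bound ps t : all prime ps ->
  0 <= brun_err ps t <= (\rsum_(p <- ps) / INR p) ^ t / INR (t`!).
Proof.
elim: ps t => [|p ps IH] [|t]; rewrite ?fact0 ?big_nil.
- by move=> _ /=; lra.
- by move=> _; rewrite /= /Rdiv !Rmult_0_l; lra.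
- by move=> _ /=; lra.
case/andP => pp aps; have [H1 H1'] := IH t.+1 aps; have [H2 H2'] := IH t aps.
have ip : 0 < / INR p by apply: Rinv_0_lt_compat; apply: INR_gt0; apply: prime_gt0.
have -> : brun_err (p :: ps) t.+1 = brun_err ps t.+1 + brun_err ps t / INR p by [].
rewrite big_cons; set s := \rsum_(q <- ps) _ in H1' H2' *.
have s0 : 0 <= s.
  apply: rsum_ge0 => q qs _; left; apply: Rinv_0_lt_compat; apply: INR_gt0.
  by apply: prime_gt0; apply: (allP aps).
split; first by rewrite /Rdiv; nra.
have f0 : 0 < INR t`! by apply: INR_gt0; apply: fact_gt0.
have t1 : 0 < INR t.+1 by apply: INR_gt0.
(* Two terms of the binomial expansion of (1/p + s)^(t+1). *)
have pw : s ^ t.+1 + INR t.+1 * (/ INR p * s ^ t) <= (/ INR p + s) ^ t.+1.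
  elim: (t) => [|k IHk]; first by rewrite /=; lra.
  have -> : (/ INR p + s) ^ k.+2 = (/ INR p + s) * (/ INR p + s) ^ k.+1 by [].
  have sk : 0 <= s ^ k by apply: pow_le.
  apply: (@Rle_trans _ ((/ INR p + s) * (s ^ k.+1 + INR k.+1 * (/ INR p * s ^ k)))); last first.
    by apply: Rmult_le_compat_l => //; lra.
  rewrite (S_INR k.+1) -!tech_pow_Rmult.
  have := pos_INR k.+1 => k0.
  have : 0 <= / INR p * (INR k.+1 * (/ INR p * s ^ k)) by apply: Rmult_le_pos; [lra|apply: Rmult_le_pos => //; nra].
  by nra.
apply: (@Rle_trans _ (s ^ t.+1 / INR (t.+1)`! + s ^ t / INR t`! / INR p)).
  by apply: Rplus_le_compat => //; apply: Rmult_le_compat_r => //; lra.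
have fE : INR (t.+1)`! = INR t.+1 * INR t`! by rewrite factS INR_muln.
rewrite fE.
have -> : s ^ t.+1 / (INR t.+1 * INR t`!) + s ^ t / INR t`! / INR p =
  (s ^ t.+1 + INR t.+1 * (/ INR p * s ^ t)) / (INR t.+1 * INR t`!).
  have p0 : INR p <> 0 by move=> E; move: ip; rewrite E Rinv_0; lra.
  by field; lra.
by apply: Rmult_le_compat_r => //; left; apply: Rinv_0_lt_compat; nra.
Qed.

Lemma brun_terms_bound ps t : 1 <= brun_terms ps t <= (1 + INR (size ps)) ^ t.
Proof.
elim: ps t => [|p ps IH] [|t]; try by rewrite /=; lra.
  by rewrite [INR _]/= Rplus_0_r pow1 /=; lra.
have [H1 H1'] := IH t.+1; have [H2 H2'] := IH t.
have -> : brun_terms (p :: ps) t.+1 = brun_terms ps t.+1 + brun_terms ps t by [].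
have -> : INR (size (p :: ps)) = INR (size ps) + 1 by rewrite -[size _]/((size ps).+1) S_INR.
set n := INR (size ps) in H1' H2' *; have n0 : 0 <= n by apply: pos_INR.
split; first lra.
apply: (@Rle_trans _ ((1 + n) ^ t * (1 + (n + 1)))).
  by move: H1'; rewrite -tech_pow_Rmult; nra.
rewrite -tech_pow_Rmult Rmult_comm; apply: Rmult_le_compat_l; first lra.
by apply: pow_incr; lra.
Qed.

Lemma exp_pow x n : exp x ^ n = exp (INR n * x).
Proof.
elim: n => [|n IH]; first by rewrite /= Rmult_0_l exp_0.
by rewrite -tech_pow_Rmult IH -exp_plus S_INR; congr exp; ring.
Qed.

(** From (1 + 1/n)^n <= e <= 3 by induction. This weak Stirling bound turns s^t / t! into (3 s /
    t)^t. *)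
Lemma pow_self_le_fact t : INR t ^ t <= 3 ^ t * INR t`!.
Proof.
elim: t => [|t IH]; first by rewrite /=; lra.
case: t IH => [|t] IH; first by rewrite /=; lra.
set n := t.+1 in IH *; have n0 : 0 < INR n by apply: INR_gt0.
rewrite factS INR_muln -!(tech_pow_Rmult _ n).
have H : INR n.+1 ^ n <= 3 * INR n ^ n.
  have -> : INR n.+1 = (1 + / INR n) * INR n by rewrite S_INR; field; lra.
  rewrite Rpow_mult_distr; apply: Rmult_le_compat_r; first by apply: pow_le; lra.
  apply: Rle_trans exp_le_3.
  have -> : exp 1 = exp (/ INR n) ^ n.
    by rewrite exp_pow Rinv_r //; lra.
  apply: pow_incr; have := exp_ineq1_le (/ INR n); have := Rinv_0_lt_compat _ n0; lra.
have H' : INR n.+1 ^ n <= 3 * (3 ^ n * INR n`!) by lra.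
have := Rmult_le_compat_l _ _ _ (pos_INR n.+1) H'; lra.
Qed.

Lemma totient_prod m : (0 < m)%N ->
  INR (totient m) = INR m * \rprod_(p <- primes m) (1 - / INR p).
Proof.
move=> m0; rewrite totientE // [X in _ = INR X * _](prod_primes_logn m0) !INR_prod -big_split /=.
rewrite big_seq [RHS]big_seq; apply: eq_bigr => p pm.
have := pm; rewrite -logn_gt0; have : prime p by move: pm; rewrite mem_primes => /andP[].
move=> /prime_gt1 p1 l0; rewrite -{2}(prednK l0) expnS !INR_muln -subn1 INR_subn1; last lia.
have := @INR_gt0 p; move=> H; field; apply: Rgt_not_eq; apply: H; lia.
Qed.

Lemma rprod_subset (I : eqType) (s s' : seq I) (F : I -> R) : uniq s -> {subset s <= s'} ->
  (forall i, i \in s' -> 0 <= F i <= 1) -> \rprod_(i <- s') F i <= \rprod_(i <- s) F i.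
Proof.
elim: s s' => [|x s IH] s' /=.
  by move=> _ _ H; rewrite big_nil; apply rprod_le1 => i Hi _; apply: H.
case/andP=> xs us sub F0.
have xs' : x \in s' by apply: sub; rewrite mem_head.
rewrite big_cons (perm_big _ (perm_to_rem xs')) big_cons /=.
apply: Rmult_le_compat_l; first by have := F0 x xs'; lra.
apply: IH => // [i Hi|i /mem_rem]; last exact: F0.
have : i \in x :: rem x s' by rewrite -(perm_mem (perm_to_rem xs')) sub // inE Hi orbT.
by rewrite inE => /orP[/eqP ix|//]; rewrite -ix Hi in xs.
Qed.

Definition totient_ratio m := INR m / INR (totient m).

Lemma totient_ratio_ge1 m : (0 < m)%N -> 1 <= totient_ratio m.
Proof.
move=> m0; have t0 : 0 < INR (totient m) by apply: INR_gt0; rewrite totient_gt0.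
apply: (Rmult_le_reg_r (INR (totient m))) => //; rewrite /totient_ratio.
have -> : INR m / INR (totient m) * INR (totient m) = INR m by field; lra.
rewrite Rmult_1_l totient_prod // -[X in _ <= X]Rmult_1_r.
apply: Rmult_le_compat_l; first exact: pos_INR.
apply rprod_le1 => p; rewrite mem_primes => /andP[/INR_prime_ge2 p2 _] _.
by have := Rinv_0_lt_compat (INR p); have : / INR p <= / 2; [apply: Rinv_le_contravar|]; lra.
Qed.

(** Primes dividing m never divide m b + 1, so they cannot be sieved by; adjoining them to complete
    the Mertens product costs the factor m / phi(m). *)
Lemma prod_primes_le_coprime m h : (0 < m)%N -> (0 < h)%N ->
  \rprod_(p <- [seq p <- primes_le (2 ^ h) | coprime m p]) (1 - / INR p)
  <= totient_ratio m * / (INR h * ln 2).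
Proof.
move=> m0 h0; set ps := filter _ _.
have t0 : 0 < INR (totient m) by apply: INR_gt0; rewrite totient_gt0.
have m0' := INR_gt0 m0.
have F01 p : prime p -> 0 <= 1 - / INR p <= 1.
  move=> /INR_prime_ge2 p2.
  by have := Rinv_0_lt_compat (INR p); have : / INR p <= / 2; [apply: Rinv_le_contravar|]; lra.
have : \rprod_(p <- ps ++ primes m) (1 - / INR p) <= \rprod_(p <- primes_le (2 ^ h)) (1 - / INR p).
  apply: rprod_subset; first exact: primes_le_uniq.
    move=> p pz; rewrite mem_cat mem_filter pz andbT.
    move: pz; rewrite mem_primes_le mem_primes m0 => /andP[pp _].
    by rewrite pp coprime_sym prime_coprime //= orNb.
  move=> p; rewrite mem_cat mem_filter mem_primes_le mem_primes.
  by case/orP => [/and3P[_ pp _]|/andP[pp _]]; apply: F01.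
rewrite big_cat /= => H.
have {H} := Rle_trans _ _ _ H (prod_primes_le_ln h0).
have E : \rprod_(p <- primes m) (1 - / INR p) = INR (totient m) / INR m.
  by rewrite totient_prod //; field; lra.
rewrite E; set Q := \rprod_(p <- ps) _; set K := / _ => H.
rewrite /totient_ratio; apply: (Rmult_le_reg_r (INR (totient m) / INR m)).
  by apply: Rmult_lt_0_compat => //; apply: Rinv_0_lt_compat.
apply: Rle_trans H _; right; field; lra.
Qed.

Lemma size_primes_le_leq z : (size (primes_le z) <= z)%N.
Proof.
have -> : z = size (iota 1 z) by rewrite size_iota.
rewrite uniq_leq_size ?primes_le_uniq // => p.
by rewrite mem_primes_le mem_iota size_iota => /andP[/prime_gt0 p0 pz]; lia.
Qed.

(** A prime m b + 1 either survives the sieve by the primes up to 2^h or is itself at most 2^h. The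
    exceptional values and the rounding errors of the sieve are each at most 2^((h+1) t), whence the
    factor 2. *)
Lemma count_primes_progression_sieve m B h t : (0 < m)%N -> (0 < h)%N -> (0 < t)%N ->
  INR (count (fun b => prime (m * b + 1)) (iota 1 B)) <=
  INR B * (totient_ratio m * / (INR h * ln 2)
           + (3 + 2 * ln (INR h)) ^ t / INR t`!) + 2 * 2 ^ (h.+1 * t)%N.
Proof.
move=> m0 h0 t0; set ps := [seq p <- primes_le (2 ^ h) | coprime m p].
have mem_ps p : p \in ps -> [/\ prime p, (p <= 2 ^ h)%N & coprime m p].
  by rewrite mem_filter mem_primes_le => /and3P[].
have ups : uniq ps by rewrite filter_uniq // primes_le_uniq.
have aps : all prime ps by apply/allP => p /mem_ps[].
have amps : all (fun p => coprime m p) ps by apply/allP => p /mem_ps[].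
have a1 : all (fun p => coprime 1 p) ps by apply/allP => p _; rewrite coprime1n.
have szps : (size ps <= 2 ^ h)%N.
  by apply: leq_trans (size_primes_le_leq _); rewrite size_filter count_size.
have := @brun_sieve B m ps t 1%N ups aps amps a1 isT (coprimen1 _).
have [_ Herr] := brun_err_bound t aps; have [_ Htm] := brun_terms_bound ps t.
have Hprod := prod_primes_le_coprime m0 h0; rewrite -/ps in Hprod.
have Hs : \rsum_(p <- ps) / INR p <= 3 + 2 * ln (INR h).
  apply: Rle_trans (sum_inv_primes h0); apply: rsum_subset => //.
    by move=> p /mem_ps[pp pz _]; rewrite mem_primes_le pp.
  move=> p; rewrite mem_primes_le => /andP[/prime_gt0 p0 _].
  by left; apply: Rinv_0_lt_compat; apply: INR_gt0.
have s0 : 0 <= \rsum_(p <- ps) / INR p.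
  apply: rsum_ge0 => p /mem_ps[/prime_gt0 p0 _ _] _.
  by left; apply: Rinv_0_lt_compat; apply: INR_gt0.
set S := brun_count _ _ _ _; set Q := \rprod_(p <- ps) _ in Hprod *.
rewrite -[INR 1]/(1) /Rdiv Rinv_1 Rmult_1_r => /(Rle_trans _ _ _ (Rle_abs _)) HS.
have f0 : 0 < / INR t`! by apply: Rinv_0_lt_compat; apply: INR_gt0; apply: fact_gt0.
have Herr' : brun_err ps t <= (3 + 2 * ln (INR h)) ^ t * / INR t`!.
  by apply: Rle_trans Herr _; apply: Rmult_le_compat_r; [lra|apply: pow_incr].
have two k : 2 ^ k = INR (2 ^ k)%N by rewrite INR_expn.
have Htm' : brun_terms ps t <= 2 ^ (h.+1 * t)%N.
  apply: Rle_trans Htm _; rewrite pow_mult; apply: pow_incr; split; first by have := pos_INR (size ps); lra.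
  rewrite -tech_pow_Rmult two; have := INR_leq szps.
  by have : 1 <= INR (2 ^ h) by [apply: INR_ge1; rewrite expn_gt0]; lra.
have cnt : (count (fun b => prime (m * b + 1)) (iota 1 B) <= S + count (fun b => m * b + 1 <= 2 ^ h) (iota 1 B))%N.
  rewrite -count_predUI; apply: leq_trans (leq_addr _ _); apply: sub_count => b /= pb.
  case: (leqP (m * b + 1) (2 ^ h)) => H; first by rewrite orbT.
  rewrite orbF dvd1n /=; apply/allP => p /mem_ps[pp pz _].
  by rewrite dvdn_prime2 //; apply/eqP => E; rewrite E in pz; lia.
have small : (count (fun b => m * b + 1 <= 2 ^ h) (iota 1 B) <= 2 ^ (h.+1 * t))%N.
  apply: (@leq_trans (2 ^ h)); last by rewrite leq_exp2l //; nia.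
  rewrite -size_filter -[X in (_ <= X)%N](size_iota 1); apply: uniq_leq_size.
    by rewrite filter_uniq // iota_uniq.
  by move=> b; rewrite mem_filter !mem_iota => /andP[]; nia.
move: (INR_leq cnt) (INR_leq small); rewrite INR_addn -two => cnt' small'.
have B0 := pos_INR B; rewrite Rmult_plus_distr_l.
have M1 := Rmult_le_compat_l _ _ _ B0 Hprod.
have M2 := Rmult_le_compat_l _ _ _ B0 Herr'.
by lra.
Qed.

Lemma ln_INR_le m n : (0 < m)%N -> (m <= n)%N -> ln (INR m) <= ln (INR n).
Proof. by move=> m0 mn; apply: ln_le; [exact: INR_gt0|exact: INR_leq]. Qed.

(* Choosing h close to i / (2 t) makes both the truncation error and the number
   of terms of the sieve negligible. *)
Lemma count_primes_progression m i t : (0 < m)%N -> (8 * t <= i)%N ->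
  18 + 12 * ln (INR i) <= INR t ->
  INR (count (fun b => prime (m * b + 1)) (iota 1 (2 ^ i))) <=
  16 * INR t * totient_ratio m * 2 ^ i / INR i.
Proof.
move=> m0 ti ht.
have t0 : (0 < t)%N by rewrite lt0n; apply/eqP => E; move: ht; rewrite E /=; have := ln_INR_ge0 i; lra.
have i0 : (0 < i)%N by lia.
set h := ((i %/ (2 * t)).-1)%N.
have q4 : (4 <= i %/ (2 * t))%N by rewrite leq_divRL; lia.
have hS : h.+1 = (i %/ (2 * t))%N by rewrite /h prednK; lia.
have ht2 : (h.+1 * t * 2 <= i)%N by have := leq_trunc_div i (2 * t); rewrite -hS; lia.
have h0 : (0 < h)%N by lia.
have ih : (i <= 4 * t * h)%N.
  have : (i < h.+2 * (2 * t))%N by rewrite hS; apply: ltn_ceil; lia.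
  have : (3 <= h)%N by lia.
  by nia.
have hi : (h <= i)%N by nia.
have := @count_primes_progression_sieve m (2 ^ i) h t m0 h0 t0.
set c := INR (count _ _).
have ratio1 := totient_ratio_ge1 m0; set rho := totient_ratio m in ratio1 *.
have L := ln2_bounds.
have h0' := INR_gt0 h0; have i0' := INR_gt0 i0; have t0' := INR_gt0 t0.
have lnh : 0 <= ln (INR h) <= ln (INR i) by split; [exact: ln_INR_ge0|exact: ln_INR_le].
have two k : INR (2 ^ k)%N = 2 ^ k by rewrite INR_expn.
have ih' : INR i <= 4 * INR t * INR h.
  by move: (INR_leq ih); rewrite !INR_muln; have -> : INR 4 = 4 by rewrite /=; lra.
have inv_h : / INR h <= 4 * INR t / INR i.
  apply: (Rmult_le_reg_r (INR h * INR i)); first nra.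
  have -> : / INR h * (INR h * INR i) = INR i by field; lra.
  by have -> : 4 * INR t / INR i * (INR h * INR i) = 4 * INR t * INR h by field; lra.
(* The hypothesis on t is 6 (3 + 2 ln h) <= t: by the Stirling bound the truncation error is then at
   most 2^(-t), and t is also large enough for 2^t >= h. *)
have err : (3 + 2 * ln (INR h)) ^ t / INR t`! <= / INR h.
  apply: (@Rle_trans _ (/ 2 ^ t)).
    have f0 : 0 < INR t`! by apply: INR_gt0; apply: fact_gt0.
    have p2 : 0 < 2 ^ t by apply: pow_lt; lra.
    apply: (Rmult_le_reg_r (INR t`! * 2 ^ t)); first nra.
    have -> : (3 + 2 * ln (INR h)) ^ t / INR t`! * (INR t`! * 2 ^ t) = (2 * (3 + 2 * ln (INR h))) ^ t.
      by rewrite Rpow_mult_distr; field; lra.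
    have -> : / 2 ^ t * (INR t`! * 2 ^ t) = INR t`! by field; lra.
    apply: (Rmult_le_reg_l (3 ^ t)); first by apply: pow_lt; lra.
    apply: Rle_trans (pow_self_le_fact t); rewrite -Rpow_mult_distr; apply: pow_incr; lra.
  apply: Rinv_le_contravar => //.
  have -> : 2 ^ t = exp (INR t * ln 2) by rewrite -exp_pow exp_ln //; lra.
  rewrite -[X in X <= _](exp_ln (INR h)) //; have [H|->] : ln (INR h) <= INR t * ln 2 by nra.
    by left; apply: exp_increasing.
  by right.
have tail : 2 * 2 ^ (h.+1 * t)%N <= 2 ^ i * (4 * INR t / INR i).
  have e1 : (i * 2 ^ (h.+1 * t) <= 2 * 2 ^ i)%N.
    apply: (@leq_trans (2 * 2 ^ (i %/ 2) * 2 ^ (i %/ 2))).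
      apply: leq_mul; last by rewrite leq_exp2l // leq_divRL.
      have := ltn_expl (i %/ 2) (isT : (1 < 2)%N); have := ltn_ceil i (isT : (0 < 2)%N).
      by lia.
    by rewrite -mulnA leq_mul2l /= -expnD leq_exp2l //; have := leq_trunc_div i 2; lia.
  move: (INR_leq e1); rewrite !INR_muln !two -[INR 2]/2 => e1'.
  have p2 : 0 < 2 ^ i by apply: pow_lt; lra.
  apply: (Rmult_le_reg_r (INR i)) => //.
  have -> : 2 ^ i * (4 * INR t / INR i) * INR i = 4 * INR t * 2 ^ i by field; lra.
  by have t1 := INR_ge1 t0; nra.
have main : rho * / (INR h * ln 2) <= rho * (2 * (4 * INR t / INR i)).
  apply: Rmult_le_compat_l; first lra.
  rewrite Rinv_mult; have : / ln 2 <= 2.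
    by rewrite -[X in _ <= X]Rinv_inv; apply: Rinv_le_contravar; lra.
  have : 0 < / ln 2 by apply: Rinv_0_lt_compat; lra.
  have : 0 < / INR h by apply: Rinv_0_lt_compat.
  by nra.
rewrite two => H; apply: Rle_trans H _.
have p2 : 0 < 2 ^ i by apply: pow_lt; lra.
(* In units of t / i the main term contributes 8 rho, the truncation error 4 and the rounding errors
   4, and rho >= 1. *)
have E : 16 * INR t * rho * 2 ^ i / INR i = 2 ^ i * (rho * 4 * (4 * INR t / INR i)) by field; lra.
rewrite E; set K := 4 * INR t / INR i in inv_h tail main *.
have K0 : 0 <= K by apply: Rmult_le_pos; [lra|left; apply: Rinv_0_lt_compat].
have := Rmult_le_compat_l _ _ _ (Rlt_le _ _ p2) main.
have := Rmult_le_compat_l _ _ _ (Rlt_le _ _ p2) (Rle_trans _ _ _ err inv_h).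
have : 2 ^ i * K <= 2 ^ i * (rho * K) by apply: Rmult_le_compat_l; nra.
by lra.
Qed.

Lemma sum_inv_dyadic (P : pred nat) i :
  \rsum_(b <- iota 1 (2 ^ i.+1) | P b) / INR b <=
  \rsum_(b <- iota 1 (2 ^ i) | P b) / INR b + INR (count P (iota (2 ^ i).+1 (2 ^ i))) / 2 ^ i.
Proof.
rewrite expnS mul2n -addnn iotaD big_cat add1n; apply: Rplus_le_compat_l.
rewrite -big_filter -size_filter /Rdiv -rsum_const; apply: rsum_le => b.
rewrite mem_filter mem_iota => /and3P[_ b1 _] _.
rewrite -[2]/(INR 2) -INR_expn; apply: Rinv_le_contravar; first by apply: INR_gt0; rewrite expn_gt0.
by apply: INR_leq; lia.
Qed.

(** Dyadic summation: the first 8 t blocks are bounded trivially by 1 each, the others by the sieve,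
    with total at most 32 t rho times a harmonic sum that is itself at most t. The constant is 1 + 8
    + 32. *)
Lemma sum_inv_primes_progression m L t : (0 < m)%N -> (0 < L)%N ->
  18 + 12 * ln (INR L) <= INR t ->
  \rsum_(b <- iota 1 (2 ^ L) | prime (m * b + 1)) / INR b <=
  41 * INR t ^ 2 * totient_ratio m.
Proof.
move=> m0 L0 ht.
have ratio1 := totient_ratio_ge1 m0; set rho := totient_ratio m in ratio1 *.
have lnL := ln_INR_ge0 L.
have t1 : 1 <= INR t by lra.
have H l : (l <= L)%N -> \rsum_(b <- iota 1 (2 ^ l) | prime (m * b + 1)) / INR b <=
    1 + INR (minn l (8 * t)) + 32 * INR t * rho * harmonic l.
  elim: l => [|l IH] lL.
    rewrite min0n /harmonic big_nil big_mkcond big_seq1 /=; case: ifP => _; lra.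
  have {IH} := IH (ltnW lL); have := sum_inv_dyadic (fun b => prime (m * b + 1)) l.
  have p2 : 0 < 2 ^ l by apply: pow_lt; lra.
  have ip2 : 0 < / 2 ^ l by apply: Rinv_0_lt_compat.
  rewrite harmonicS; set c := count _ _.
  have il : 0 < / INR l.+1 by apply: Rinv_0_lt_compat; apply: INR_gt0.
  have [lt|lt] : (l < 8 * t)%N \/ (8 * t <= l)%N by lia.
    have -> : minn l (8 * t) = l by lia.
    have -> : minn l.+1 (8 * t) = l.+1 by lia.
    have : INR c / 2 ^ l <= 1.
      have : INR c <= 2 ^ l.
        have -> : 2 ^ l = INR (2 ^ l)%N by rewrite INR_expn.
        by apply: INR_leq; apply: leq_trans (count_size _ _) _; rewrite size_iota.
      by move=> Hc; apply: (Rmult_le_reg_r (2 ^ l)) => //; rewrite /Rdiv Rmult_assoc Rinv_l; lra.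
    have : 0 <= 32 * INR t * rho * / INR l.+1 by apply: Rmult_le_pos; [nra|lra].
    by rewrite S_INR; lra.
  have -> : minn l (8 * t) = (8 * t)%N by lia.
  have -> : minn l.+1 (8 * t) = (8 * t)%N by lia.
  have ht' : 18 + 12 * ln (INR l.+1) <= INR t.
    by have := @ln_INR_le l.+1 L isT lL; lra.
  have := @count_primes_progression m l.+1 t m0 (leqW lt) ht'.
  have : INR c <= INR (count (fun b => prime (m * b + 1)) (iota 1 (2 ^ l.+1))).
    by apply: INR_leq; rewrite expnS mul2n -addnn iotaD count_cat add1n leq_addl.
  set C := INR (count _ _) => cC CB.
  have : INR c / 2 ^ l <= 32 * INR t * rho * / INR l.+1.
    apply: (@Rle_trans _ (16 * INR t * rho * 2 ^ l.+1 / INR l.+1 / 2 ^ l)).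
      by apply: Rmult_le_compat_r; [left|exact: Rle_trans cC CB].
    have l0 := INR_gt0 (isT : (0 < l.+1)%N); right; rewrite -(tech_pow_Rmult _ l).
    by move: (INR l.+1) l0 (2 ^ l) p2 => x x0 y y0; field; lra.
  by lra.
apply: Rle_trans (H L (leqnn L)) _.
have [_ hL] := harmonic_bounds L; have {}hL := hL L0; have h0 := harmonic_ge0 L.
have m8 : INR (minn L (8 * t)) <= 8 * INR t.
  have -> : 8 * INR t = INR (8 * t)%N by rewrite INR_muln; congr Rmult; rewrite /=; lra.
  by apply: INR_leq; apply: geq_minr.
have : 32 * INR t * rho * harmonic L <= 32 * INR t * rho * INR t.
  by apply: Rmult_le_compat_l; [nra|lra].
have : INR t <= INR t ^ 2 by nra.
by nra.
Qed.

(** * Exponential moments of the smooth part *)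

(** The geometric sum runs over a range independent of v, so that it can be exchanged with a sum
    over a when v is a valuation of a. *)
Lemma pow_telescope x v N : (v <= N)%N ->
  x ^ v = 1 + (x - 1) * \rsum_(w <- iota 0 N | (w < v)%N) x ^ w.
Proof.
move=> vN.
have -> : \rsum_(w <- iota 0 N | (w < v)%N) x ^ w = \rsum_(w <- iota 0 v) x ^ w.
  rewrite -(subnKC vN) iotaD big_cat /= add0n [X in _ + X]big_seq_cond.
  rewrite [X in _ + X]big1 => [|w]; last first.
    by rewrite mem_iota => /andP[/andP[H _] H']; lia.
  rewrite Rplus_0_r big_seq_cond [RHS]big_seq; apply: eq_bigl => w.
  by rewrite mem_iota /= add0n andbb.
elim: v {vN} => [|v IH]; first by rewrite big_nil /=; ring.
rewrite -(addn1 v) iotaD big_cat big_seq1 add0n addn1 -tech_pow_Rmult.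
set S := \big[_/_]_(i <- _) _ in IH *; rewrite Rmult_plus_distr_l -Rplus_assoc -IH; ring.
Qed.

Lemma rprod_le (I : eqType) (s : seq I) (F G : I -> R) :
  (forall i, i \in s -> 0 <= F i <= G i) -> \rprod_(i <- s) F i <= \rprod_(i <- s) G i.
Proof.
elim: s => [|i s IH] H; first by rewrite !big_nil; lra.
have H' j : j \in s -> 0 <= F j <= G j by move=> js; apply: H; rewrite inE js orbT.
rewrite !big_cons; have := H i (mem_head _ _).
have : 0 <= \rprod_(j <- s) F j by apply: rprod_ge0 => j js _; have := H' j js; lra.
by have := IH H'; move=> ? ? ?; apply: Rmult_le_compat; lra.
Qed.

Lemma geom_sum_le y N : 0 <= y <= 3 / 4 -> \rsum_(w <- iota 0 N) y ^ w <= 4.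
Proof.
move=> y01; suff : \rsum_(w <- iota 0 N) y ^ w <= 4 - 4 * y ^ N.
  by have := pow_le y N (proj1 y01); lra.
elim: N => [|N IH]; first by rewrite big_nil /=; lra.
rewrite -(addn1 N) iotaD big_cat big_seq1 add0n addn1 -tech_pow_Rmult.
have y0 := pow_le y N (proj1 y01); have : 4 * y * y ^ N <= 3 * y ^ N; first by apply: Rmult_le_compat_r; lra.
by rewrite /= in IH *; lra.
Qed.

(* One Euler factor of the moment bound: x plays the role of p^sigma. *)
Lemma moment_step N (w : nat -> R) B p x e : prime p -> 1 <= x -> x <= 3 / 4 * INR p ->
  (forall a, 0 <= w a) -> 0 <= B -> (0 < e)%N -> coprime e p ->
  (forall k, \rsum_(a <- iota 1 N | (e * p ^ k %| a)%N) w a <= B / INR (totient (e * p ^ k))) ->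
  \rsum_(a <- iota 1 N | (e %| a)%N) (w a * x ^ logn p a)
  <= B * (1 + 8 * (x - 1) / INR p) / INR (totient e).
Proof.
move=> pp x1 xp w0 B0 e0 ep H.
have p2 := INR_prime_ge2 pp; have p0 := prime_gt0 pp.
have te0 : 0 < INR (totient e) by apply: INR_gt0; rewrite totient_gt0.
(* Telescoping x^(v_p(a)) and exchanging the sums leaves, for each k, a sum of w over the multiples
   of e p^(k+1). *)
have -> : \rsum_(a <- iota 1 N | (e %| a)%N) (w a * x ^ logn p a) =
  \rsum_(a <- iota 1 N | (e %| a)%N) w a +
  (x - 1) * \rsum_(k <- iota 0 N) (x ^ k * \rsum_(a <- iota 1 N | (e * p ^ k.+1 %| a)%N) w a).
  have -> : \rsum_(k <- iota 0 N) (x ^ k * \rsum_(a <- iota 1 N | (e * p ^ k.+1 %| a)%N) w a) =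
      \rsum_(k <- iota 0 N) \rsum_(a <- iota 1 N | (e %| a)%N)
        (if (p ^ k.+1 %| a)%N then x ^ k * w a else 0).
    apply: eq_bigr => k _; rewrite -rsum_mull -big_mkcondr /=; apply: eq_bigl => a.
    by rewrite Gauss_dvd // coprimeXr.
  rewrite exchange_big /= -rsum_mull -big_split /= big_seq_cond [RHS]big_seq_cond.
  apply: eq_bigr => a; rewrite mem_iota => /andP[aN _].
  have vN : (logn p a <= N)%N.
    have := ltn_logl p (_ : 0 < a)%N; move=> Hl; apply: leq_trans (ltnW (Hl _)) _; lia.
  rewrite (pow_telescope x vN) -big_mkcond /= (big_mkcond (fun k => _ %| _)%N).
  rewrite [in LHS]big_mkcond /= -!rsum_mull Rmult_plus_distr_l Rmult_1_r; congr Rplus.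
  rewrite -!rsum_mull; apply: eq_bigr => k _; rewrite pfactor_dvdn //; last lia.
  by case: ifP => _; ring.
have H0 := H 0%N; rewrite expn0 muln1 in H0.
have Hk k : (x ^ k * (\rsum_(a <- iota 1 N | (e * p ^ k.+1 %| a)%N) w a)) <=
    B / INR (totient e) * (/ (INR p - 1)) * (x / INR p) ^ k.
  apply: (@Rle_trans _ (x ^ k * (B / INR (totient (e * p ^ k.+1))))).
    by apply: Rmult_le_compat_l; [apply: pow_le; lra|exact: H].
  rewrite totient_coprime ?coprimeXr // totient_pfactor // !INR_muln INR_expn -subn1 INR_subn1 //.
  rewrite [k.+1.-1]/=; right; rewrite Rpow_mult_distr pow_inv.
  have pk : 0 < INR p ^ k by apply: pow_lt; lra.
  by field; lra.
(* The ratio x / p is at most 3/4, so the geometric series is at most 4; together with 1 / (p - 1)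
   <= 2 / p this is the factor 8. *)
have Hsum : \rsum_(k <- iota 0 N) (x ^ k * \rsum_(a <- iota 1 N | (e * p ^ k.+1 %| a)%N) w a)
    <= B / INR (totient e) * (/ (INR p - 1)) * 4.
  apply: Rle_trans (_ : _ <= \rsum_(k <- iota 0 N) (B / INR (totient e) * (/ (INR p - 1)) * (x / INR p) ^ k)) _.
    by apply: rsum_le => k _ _; apply: Hk.
  rewrite rsum_mull; apply: Rmult_le_compat_l.
    apply: Rmult_le_pos; last by left; apply: Rinv_0_lt_compat; lra.
    by apply: Rmult_le_pos => //; left; apply: Rinv_0_lt_compat.
  apply: geom_sum_le; split; first by apply: Rmult_le_pos; [lra|left; apply: Rinv_0_lt_compat; lra].
  by apply: (Rmult_le_reg_r (INR p)); [lra|rewrite /Rdiv Rmult_assoc Rinv_l; lra].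
have pinv : / (INR p - 1) <= 2 / INR p.
  apply: (Rmult_le_reg_r ((INR p - 1) * INR p)); first nra.
  have -> : / (INR p - 1) * ((INR p - 1) * INR p) = INR p by field; lra.
  have -> : 2 / INR p * ((INR p - 1) * INR p) = 2 * (INR p - 1) by field; lra.
  by lra.
have BT : 0 <= B / INR (totient e) by apply: Rmult_le_pos => //; left; apply: Rinv_0_lt_compat.
apply: Rle_trans (Rplus_le_compat _ _ _ _ H0 (Rmult_le_compat_l _ _ _ _ Hsum)) _; first lra.
have -> : B * (1 + 8 * (x - 1) / INR p) / INR (totient e) =
  B / INR (totient e) + (x - 1) * (B / INR (totient e) * (2 / INR p) * 4) by field; lra.
apply: Rplus_le_compat_l; apply: Rmult_le_compat_l; first lra.
by apply: Rmult_le_compat_r; [lra|apply: Rmult_le_compat_l].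
Qed.

(** The weight w is arbitrary so that each prime's factor can be absorbed into it before the next
    prime is treated. The divisor hypothesis covers all moduli supported on ps, hence survives the
    induction in the form needed for e p^k. *)
Lemma moment_bound N (ps : seq nat) (w : nat -> R) B (x : nat -> R) :
  uniq ps -> all prime ps ->
  (forall p, p \in ps -> 1 <= x p /\ x p <= 3 / 4 * INR p) ->
  (forall a, 0 <= w a) -> 0 <= B ->
  (forall e, (0 < e)%N -> all (mem ps) (primes e) ->
     \rsum_(a <- iota 1 N | (e %| a)%N) w a <= B / INR (totient e)) ->
  \rsum_(a <- iota 1 N) (w a * \rprod_(p <- ps) x p ^ logn p a)
  <= B * \rprod_(p <- ps) (1 + 8 * (x p - 1) / INR p).
Proof.
elim: ps w B => [|p ps IH] w B.
  move=> _ _ _ w0 B0 H; rewrite big_nil Rmult_1_r.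
  have := H 1%N isT isT; rewrite /Rdiv [INR _]/= Rinv_1 Rmult_1_r.
  rewrite (eq_bigl xpredT) => [H1|a]; last by rewrite dvd1n.
  by under eq_bigr => a _ do rewrite big_nil Rmult_1_r.
case/andP => pps ups /andP[pp aps] hx w0 B0 H.
have [xp1 xp2] := hx p (mem_head _ _).
have p0 := prime_gt0 pp; have p2 := INR_prime_ge2 pp.
have K0 : 0 <= 1 + 8 * (x p - 1) / INR p.
  have : 0 <= 8 * (x p - 1) / INR p; last lra.
  by apply: Rmult_le_pos; [lra|left; apply: Rinv_0_lt_compat; lra].
have := IH (fun a => w a * x p ^ logn p a) (B * (1 + 8 * (x p - 1) / INR p)) ups aps.
rewrite big_cons -Rmult_assoc => IH'.
under eq_bigr => a _ do rewrite big_cons -Rmult_assoc.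
apply: IH'.
- by move=> q qs; apply: hx; rewrite inE qs orbT.
- by move=> a; apply: Rmult_le_pos => //; apply: pow_le; lra.
- exact: Rmult_le_pos.
move=> e e0 he; apply: moment_step => //.
  rewrite coprime_sym prime_coprime //; apply/negP => pe; move: pps.
  by have := allP he p; rewrite mem_primes pp e0 pe => /(_ isT) /= ->.
move=> k; apply: H; first by rewrite muln_gt0 e0 expn_gt0 p0.
apply/allP => q; rewrite primesM ?expn_gt0 ?p0 // => /orP[qe|qp].
  by have /= qs := allP he q qe; rewrite /= inE qs orbT.
move: qp; rewrite mem_primes => /and3P[pq _]; rewrite Euclid_dvdX // => /andP[].
by rewrite dvdn_prime2 // => /eqP -> _; rewrite /= mem_head.
Qed.

Definition smooth_log h a := \rsum_(p <- primes_le (2 ^ h)) (INR (logn p a) * ln (INR p)).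

Lemma smooth_log_ge0 h a : 0 <= smooth_log h a.
Proof. by apply: rsum_ge0 => p _ _; apply: Rmult_le_pos; [exact: pos_INR|exact: ln_INR_ge0]. Qed.

(* The 2^h-smooth part of a to the power 1 / (2 ln 2^h). *)
Definition smooth_weight h a := exp (smooth_log h a / (2 * (INR h * ln 2))).

Lemma smooth_weight_prod h a : smooth_weight h a =
  \rprod_(p <- primes_le (2 ^ h)) exp (ln (INR p) / (2 * (INR h * ln 2))) ^ logn p a.
Proof.
rewrite /smooth_weight /smooth_log /Rdiv big_distrl /= exp_rsum; apply: eq_bigr => p _.
by rewrite exp_pow; congr exp; ring.
Qed.

Lemma exp_le_1_2x y : 0 <= y <= / 2 -> exp y <= 1 + 2 * y.
Proof.
move=> y01; have := exp_ineq1_le (- y); rewrite exp_Ropp; have e0 := exp_pos y => H.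
have : (1 - y) * exp y <= 1.
  have := Rmult_le_compat_r _ _ _ (Rlt_le _ _ e0) H; rewrite Rinv_l; lra.
have : (1 - y) * (1 + 2 * y) >= 1 by nra.
by nra.
Qed.

(** Here x(p) = p^sg with sg = 1 / (2 ln 2^h), so sg ln p <= 1/2 and x(p) - 1 <= 2 sg ln p. The
    Euler factors multiply to at most the exponential of 16 sg times the sum of ln p / p, which is
    at most 4 ln 2^h; this gives 32. The condition h >= 2 ensures x(2) <= 3/2 = (3/4) 2. *)
Lemma smooth_weight_moment h N (w : nat -> R) B : (2 <= h)%N -> (forall a, 0 <= w a) -> 0 <= B ->
  (forall e, (0 < e)%N -> (forall p, p \in primes e -> (p <= 2 ^ h)%N) ->
     \rsum_(a <- iota 1 N | (e %| a)%N) w a <= B / INR (totient e)) ->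
  \rsum_(a <- iota 1 N) (w a * smooth_weight h a) <= B * exp 32.
Proof.
move=> h2 w0 B0 H; have L := ln2_bounds.
have h2' : 2 <= INR h by have := INR_leq h2; rewrite -[INR 2]/2.
set sg := / (2 * (INR h * ln 2)).
have sg0 : 0 < sg by apply: Rinv_0_lt_compat; nra.
have sgE : sg * (2 * (INR h * ln 2)) = 1 by rewrite /sg Rinv_l; nra.
have mp p : p \in primes_le (2 ^ h) -> prime p /\ 0 <= ln (INR p) * sg <= / 2.
  rewrite mem_primes_le => /andP[pp pY]; split=> //.
  have lp := ln_INR_ge0 p; split; first nra.
  have := ln_INR_le (prime_gt0 pp) pY; rewrite ln_exp2; nra.
under eq_bigr => a _ do rewrite smooth_weight_prod.
pose x p := exp (ln (INR p) / (2 * (INR h * ln 2))).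
apply: Rle_trans (@moment_bound N (primes_le (2 ^ h)) w B x _ _ _ _ _ _) _ => //.
- exact: primes_le_uniq.
- by apply/allP => p /mp[].
- move=> p /mp[pp lp]; rewrite /x /Rdiv -/sg; split.
    by have := exp_ineq1_le (ln (INR p) * sg); lra.
  have := exp_le_1_2x lp; have p2 := INR_prime_ge2 pp.
  case: (eqVneq p 2%N) => [->|pn2].
    by rewrite -[INR 2]/2; nra.
  have : 3 <= INR p.
    by have -> : 3 = INR 3 by [rewrite /=; lra]; apply: INR_leq; move: (prime_gt1 pp) pn2; lia.
  by lra.
- by move=> e e0 /allP he; apply: H => // p /he; rewrite /= mem_primes_le => /andP[].
apply: Rmult_le_compat_l => //.
apply: (@Rle_trans _ (exp (\rsum_(p <- primes_le (2 ^ h)) (16 * sg * (ln (INR p) / INR p))))).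
  rewrite exp_rsum; apply: rprod_le => p ph.
  have [pp lp] := mp p ph; have p2 := INR_prime_ge2 pp.
  have ip : 0 < / INR p by apply: Rinv_0_lt_compat; lra.
  have x1 : 1 <= x p <= 1 + 2 * (ln (INR p) * sg).
    rewrite /x /Rdiv -/sg; have := exp_ineq1_le (ln (INR p) * sg); have := exp_le_1_2x lp; lra.
  have : 1 + 8 * (x p - 1) / INR p <= exp (16 * sg * (ln (INR p) / INR p)).
    apply: Rle_trans (exp_ineq1_le _); apply: Rplus_le_compat_l.
    have -> : 16 * sg * (ln (INR p) / INR p) = (16 * (ln (INR p) * sg)) / INR p by field; lra.
    by apply: Rmult_le_compat_r; lra.
  have : 0 <= 8 * (x p - 1) / INR p by apply: Rmult_le_pos; lra.
  by lra.
rewrite rsum_mull; have := sum_ln_primes h; set S := \rsum_(p <- _) _ => HS.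
have : 16 * sg * S <= 32 by nra.
by case=> [E|->]; [left; apply: exp_increasing|right].
Qed.

Lemma totient_ratioM a b : (0 < a)%N -> (0 < b)%N -> coprime a b ->
  totient_ratio (a * b) = totient_ratio a * totient_ratio b.
Proof.
move=> a0 b0 ab; rewrite /totient_ratio totient_coprime // !INR_muln.
have ta : 0 < INR (totient a) by apply: INR_gt0; rewrite totient_gt0.
have tb : 0 < INR (totient b) by apply: INR_gt0; rewrite totient_gt0.
by field; lra.
Qed.

(** Restricting a to multiples of a smooth e replaces r by r e in the progression and divides the
    sum by e. Since r is coprime to e, the sieve contributes the factor e / phi(e), which leaves
    exactly the B / phi(e) required by the moment bound. *)
Lemma smooth_weight_progression h L t r : (2 <= h)%N -> (0 < L)%N ->
  18 + 12 * ln (INR L) <= INR t -> (0 < r)%N ->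
  (forall p, prime p -> (p <= 2 ^ h)%N -> ~~ (p %| r)%N) ->
  \rsum_(a <- iota 1 (2 ^ L) | prime (r * a + 1)) (smooth_weight h a / INR a) <=
  41 * exp 32 * INR t ^ 2 * totient_ratio r.
Proof.
move=> h2 L0 ht r0 rh.
have rho1 := totient_ratio_ge1 r0.
pose w a := if prime (r * a + 1) then / INR a else 0.
have inv0 a : 0 <= / INR a.
  by case: a => [|a]; [rewrite /= Rinv_0; lra|left; apply: Rinv_0_lt_compat; apply: INR_gt0].
have w0 a : 0 <= w a by rewrite /w; case: ifP => _; [exact: inv0|lra].
set B := 41 * INR t ^ 2 * totient_ratio r.
have B0 : 0 <= B by rewrite /B; have := pow2_ge_0 (INR t); nra.
have -> : 41 * exp 32 * INR t ^ 2 * totient_ratio r = B * exp 32 by rewrite /B; ring.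
have -> : \rsum_(a <- iota 1 (2 ^ L) | prime (r * a + 1)) (smooth_weight h a / INR a) =
    \rsum_(a <- iota 1 (2 ^ L)) (w a * smooth_weight h a).
  rewrite big_mkcond; apply: eq_bigr => a _; rewrite /w; case: ifP => _; rewrite ?Rmult_0_l //.
  by rewrite /Rdiv Rmult_comm.
apply: smooth_weight_moment => // e e0 he.
apply: Rle_trans (rsum_multiples (2 ^ L) e0 w0) _.
have cre : coprime r e.
  rewrite /coprime; have g0 : (0 < gcdn r e)%N by rewrite gcdn_gt0 r0.
  case: (leqP (gcdn r e) 1) => [|g1]; first by lia.
  have pp := pdiv_prime g1; have pg := pdiv_dvd (gcdn r e).
  have pe : (pdiv (gcdn r e) %| e)%N := dvdn_trans pg (dvdn_gcdr _ _).
  have pY : (pdiv (gcdn r e) <= 2 ^ h)%N by apply: he; rewrite mem_primes pp e0.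
  by have := rh _ pp pY; rewrite (dvdn_trans pg (dvdn_gcdl _ _)).
have re0 : (0 < r * e)%N by rewrite muln_gt0 r0.
have e0' := INR_gt0 e0.
have te0 : 0 < INR (totient e) by apply: INR_gt0; rewrite totient_gt0.
have := sum_inv_primes_progression re0 L0 ht.
rewrite totient_ratioM // => H.
apply: (@Rle_trans _ (/ INR e * (41 * INR t ^ 2 * (totient_ratio r * totient_ratio e)))); last first.
  by right; rewrite /B /totient_ratio; have := INR_gt0 r0; have : 0 < INR (totient r) by [apply: INR_gt0; rewrite totient_gt0]; move=> ? ?; field; lra.
apply: Rle_trans (Rmult_le_compat_l _ _ _ _ H); last by left; apply: Rinv_0_lt_compat.
rewrite -rsum_mull big_mkcond [X in _ <= X]big_mkcond; right; apply: eq_bigr => a _.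
rewrite /w mulnA; case: ifP => _ //; rewrite INR_muln Rinv_mult; lra.
Qed.

(** * Trees of prime factors of p - 1 *)

Lemma inv_INR_ge0 a : 0 <= / INR a.
Proof. by case: a => [|a]; [rewrite /= Rinv_0; lra|left; apply: Rinv_0_lt_compat; apply: INR_gt0]. Qed.

Lemma rsum_union_bound (I J : eqType) (s : seq I) (t : seq J) (P : pred I) (Q : J -> pred I)
    (F : I -> R) : (forall i, 0 <= F i) ->
  (forall i, i \in s -> P i -> exists2 j, j \in t & Q j i) ->
  \rsum_(i <- s | P i) F i <= \rsum_(j <- t) \rsum_(i <- s | Q j i) F i.
Proof.
move=> F0 H; under [X in _ <= X]eq_bigr => j _ do rewrite big_mkcond.
rewrite exchange_big /= big_mkcond; apply: rsum_le => i si _.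
have ge0 j : j \in t -> 0 <= (if Q j i then F i else 0) by move=> _; case: ifP => _; [exact: F0|lra].
case: ifP => Pi; last by apply: rsum_ge0 => j jt _; apply: ge0.
have [j jt Qj] := H i si Pi.
by have := @rsum_ge_term _ t _ j jt ge0; rewrite Qj.
Qed.

(** The index j is the number of levels still below the child, so the cutoff shrinks as one
    descends. *)
Definition children (h : nat -> nat) j n := [seq r <- primes (n - 1) | (2 ^ h j < r)%N].

Fixpoint desc (h : nat -> nat) j n : seq nat :=
  n :: if j is j'.+1 then flatten [seq desc h j' r | r <- children h j' n] else [::].

(** The clauses with [desc] guard against repeated primes in the tree. The clause on r * r serves
    the mass estimate: the primes of n - 1 above the cutoff occur to the first power. Bounding t
    from below by the lowest cutoff provides the convergent tail in the density estimate. *)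
Fixpoint collides (h : nat -> nat) j n : bool :=
  if j is j'.+1 then
    [|| has (collides h j') (children h j' n),
        has (fun r => r * r %| n - 1)%N (children h j' n)
      | has (fun t => has (fun r => has (fun r' =>
          [&& r != r', t \in desc h j' r & t \in desc h j' r'])
          (children h j' n)) (children h j' n)) (iota (2 ^ h 0%N).+1 n)]
  else false.

Lemma mem_children h j n r : r \in children h j n ->
  [/\ prime r, (2 ^ h j < r)%N, (r %| n - 1)%N & (r < n)%N].
Proof.
rewrite mem_filter mem_primes => /andP[rY /and3P[pr n0 rn]]; split=> //.
by have := dvdn_leq n0 rn; lia.
Qed.

Lemma desc_le h j n t : t \in desc h j n -> (t <= n)%N.
Proof.
elim: j n => [|j IH] n /=; rewrite in_cons => /orP[/eqP ->|] //.
by move/flatten_mapP => [r /mem_children[_ _ _ rn] /IH]; lia.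
Qed.

Lemma desc_gt h j n t : {homo h : x y / (x <= y)%N} -> t \in desc h j n ->
  (2 ^ h 0%N < n)%N -> (2 ^ h 0%N < t)%N.
Proof.
move=> hmono; elim: j n => [|j IH] n /=; rewrite in_cons => /orP[/eqP ->|] //.
move/flatten_mapP => [r /mem_children[_ rY _ rn] /IH H] _; apply: H.
by apply: leq_ltn_trans rY; rewrite leq_exp2l // hmono.
Qed.

Lemma flatten_map_uniq (T U : eqType) (f : T -> seq U) (s : seq T) : uniq s ->
  (forall x, x \in s -> uniq (f x)) ->
  (forall x y t, x \in s -> y \in s -> t \in f x -> t \in f y -> x = y) ->
  uniq (flatten (map f s)).
Proof.
elim: s => [//|x s IH] /= /andP[xs us] Hu Hd; rewrite cat_uniq Hu ?mem_head //=.
rewrite IH ?andbT //.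
- apply/hasPn => t /flatten_mapP[y ys ty]; apply/negP => tx.
  have E : x = y by apply: (Hd x y t) => //; rewrite ?mem_head // inE ys orbT.
  by rewrite E ys in xs.
- by move=> y ys; apply: Hu; rewrite inE ys orbT.
- by move=> y z t ys zs; apply: Hd; rewrite inE ?ys ?zs orbT.
Qed.

Lemma desc_uniq h j n : {homo h : x y / (x <= y)%N} -> ~~ collides h j n -> uniq (desc h j n).
Proof.
move=> hmono; elim: j n => [//|j IH] n /=; rewrite !negb_or => /and3P[/hasPn H1 _ /hasPn H3].
apply/andP; split.
  apply/negP => /flatten_mapP[r /mem_children[_ _ _ rn] /desc_le]; lia.
apply: flatten_map_uniq; first by rewrite filter_uniq // primes_uniq.
  by move=> r /H1; apply: IH.
move=> r r' t rc rc' tr tr'; apply/eqP; apply: contraT => rr'.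
have [_ rY _ rn] := mem_children rc.
have tY : (2 ^ h 0%N < t)%N.
  by apply: desc_gt tr _ => //; apply: leq_ltn_trans rY; rewrite leq_exp2l // hmono.
have tn := desc_le tr.
have := H3 t; rewrite mem_iota tY => /(_ _)/hasPn/(_ r rc)/hasPn/(_ r' rc').
rewrite rr' tr tr'; apply; lia.
Qed.

Lemma sum_inv_residue1 N d : (0 < d)%N ->
  \rsum_(n <- iota 1 N | (1 < n)%N && (d %| n - 1)%N) / INR n <= harmonic N / INR d.
Proof.
move=> d0; apply: (@Rle_trans _ (\rsum_(a <- iota 1 N) / INR (d * a + 1))).
  apply: (@rsum_le_map _ _ _ _ _ _ (fun a => d * a + 1)%N (fun n => / INR n)); first exact: iota_uniq.
    move=> n; rewrite mem_iota => nN /andP[n1 /dvdnP[a an]]; exists a; last by rewrite mulnC -an; lia.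
    by rewrite mem_iota andbT; nia.
  by move=> a _ _; apply: inv_INR_ge0.
rewrite /harmonic /Rdiv Rmult_comm -rsum_mull; apply: rsum_le => a; rewrite mem_iota => aN _.
rewrite -Rinv_mult -INR_muln; apply: Rinv_le_contravar; first by apply: INR_gt0; rewrite muln_gt0 d0; lia.
by apply: INR_leq; lia.
Qed.

Lemma sum_inv_children h j N r :
  \rsum_(n <- iota 1 N | r \in children h j n) / INR n <= harmonic N / INR r.
Proof.
case: (posnP r) => [->|r0].
  rewrite big_pred0 => [|n]; first by rewrite /= /Rdiv Rinv_0 Rmult_0_r; lra.
  by apply/negP => /mem_children[].
apply: Rle_trans (sum_inv_residue1 N r0); apply: rsum_pred_le; first by move=> *; apply: inv_INR_ge0.
by move=> n _ /mem_children[pr _ -> rn]; rewrite andbT; have := prime_gt1 pr; lia.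
Qed.

(** Each edge from a child to its possible parents costs a factor [harmonic N]; the 1 accounts for t
    being the root itself. *)
Lemma sum_inv_ancestors h j N t : (0 < t)%N ->
  \rsum_(n <- iota 1 N | t \in desc h j n) / INR n <= (1 + harmonic N) ^ j / INR t.
Proof.
move=> t0; have H0 := harmonic_ge0 N; have it := inv_INR_ge0 t.
have base : \rsum_(n <- iota 1 N | t == n) / INR n <= / INR t.
  apply: (@Rle_trans _ (\rsum_(n <- [:: t]) / INR n)); last by rewrite big_seq1; lra.
  rewrite -big_filter; apply: rsum_subset; first by rewrite filter_uniq // iota_uniq.
    by move=> n; rewrite mem_filter inE eq_sym => /andP[].
  by move=> n _; apply: inv_INR_ge0.
elim: j => [|j IH].
  by rewrite /= /Rdiv Rmult_1_l; under eq_bigl => n do rewrite inE.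
apply: (@Rle_trans _ (/ INR t + \rsum_(r <- iota 1 N | t \in desc h j r)
    \rsum_(n <- iota 1 N | r \in children h j n) / INR n)).
  rewrite (bigID (fun n => t == n)) /=; apply: Rplus_le_compat.
    apply: Rle_trans base; apply: rsum_pred_le; first by move=> *; apply: inv_INR_ge0.
    by move=> n _ /andP[].
  rewrite -(big_filter (iota 1 N) (fun r => t \in desc h j r)).
  apply: rsum_union_bound; first exact: inv_INR_ge0.
  move=> n; rewrite mem_iota => nN /andP[]; rewrite /= in_cons => /orP[/eqP ->|]; first by rewrite eqxx.
  move/flatten_mapP => [r rc tr] _; exists r => //; rewrite mem_filter tr mem_iota.
  by have [pr _ _ rn] := mem_children rc; have := prime_gt0 pr; lia.
apply: (@Rle_trans _ (/ INR t + \rsum_(r <- iota 1 N | t \in desc h j r) (harmonic N * / INR r))).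
  by apply: Rplus_le_compat_l; apply: rsum_le => r _ _; apply: sum_inv_children.
rewrite rsum_mull -tech_pow_Rmult.
have p1 : 1 <= (1 + harmonic N) ^ j by apply: pow_R1_Rle; lra.
move: IH p1; rewrite /Rdiv; move: (\rsum_(n <- _ | _) _) ((1 + harmonic N) ^ j).
move: (harmonic N) H0 (/ INR t) it => H H0 u u0 S P IH P1.
have : H * S <= H * (P * u) by apply: Rmult_le_compat_l.
have : u <= P * u by nra.
by lra.
Qed.

Lemma sum_inv_sqr N Y : (0 < Y)%N -> \rsum_(t <- iota 1 N | (Y < t)%N) (/ INR t) ^ 2 <= / INR Y.
Proof.
move=> Y0; have Y0' := INR_gt0 Y0.
suff : \rsum_(t <- iota 1 N | (Y < t)%N) (/ INR t) ^ 2 <= / INR Y - / INR (maxn Y N).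
  by have := inv_INR_ge0 (maxn Y N); lra.
elim: N => [|N IH]; first by rewrite big_nil maxn0; lra.
rewrite -(addn1 N) iotaD big_cat add1n addn1 [X in _ + X <= _]big_mkcond big_seq1.
have [YN|YN] : (N < Y)%N \/ (Y <= N)%N by lia.
  rewrite ifF; last lia.
  have [e1 e2] : maxn Y N = Y /\ maxn Y N.+1 = Y by lia.
  by rewrite e2 Rplus_0_r; rewrite e1 in IH.
rewrite ifT; last lia.
have -> : maxn Y N.+1 = N.+1 by lia.
have mE : maxn Y N = N by lia.
rewrite mE in IH; apply: Rle_trans (Rplus_le_compat_r _ _ _ IH) _.
have N0 : 0 < INR N by apply: INR_gt0; lia.
have -> : INR N.+1 = INR N + 1 by rewrite S_INR.
move: (INR N) N0 => x x0.
have : / x - / (x + 1) - (/ (x + 1)) ^ 2 = / (x * (x + 1) ^ 2) by field; lra.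
have : 0 < / (x * (x + 1) ^ 2) by apply: Rinv_0_lt_compat; nra.
by lra.
Qed.

(** A union bound over the clauses. A collision below a child costs one more factor H by induction;
    r^2 dividing n - 1 costs H / r^2; a prime t below two distinct children r, r' makes r r' divide
    n - 1, and summing H / (r r') over the ancestors of t gives H times the square of the ancestor
    bound. The last two leave a sum of 1 / t^2 beyond the lowest cutoff. *)
Lemma sum_inv_collides h j N : {homo h : x y / (x <= y)%N} ->
  \rsum_(n <- iota 1 N | collides h j n) / INR n
  <= 2 * INR j * (1 + harmonic N) ^ (2 * j + 1) * / INR (2 ^ h 0%N).
Proof.
move=> hmono; have H0 := harmonic_ge0 N; set H := harmonic N in H0 *.
set Y := (2 ^ h 0%N)%N; have Y0 : (0 < Y)%N by rewrite expn_gt0.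
have iY := Rinv_0_lt_compat _ (INR_gt0 Y0).
have pow_ge0 e : 0 <= (1 + H) ^ e by apply: pow_le; lra.
elim: j => [|j IH]; first by rewrite big_pred0 //=; lra.
have B1 : \rsum_(n <- iota 1 N | has (collides h j) (children h j n)) / INR n
    <= H * (2 * INR j * (1 + H) ^ (2 * j + 1) * / INR Y).
  apply: Rle_trans (Rmult_le_compat_l _ _ _ H0 IH); rewrite -rsum_mull.
  apply: (@Rle_trans _ (\rsum_(r <- iota 1 N | collides h j r)
      \rsum_(n <- iota 1 N | r \in children h j n) / INR n)).
    rewrite -(big_filter (iota 1 N) (collides h j)).
    apply: rsum_union_bound; first exact: inv_INR_ge0.
    move=> n; rewrite mem_iota => nN /hasP[r rc br]; exists r => //; rewrite mem_filter br mem_iota.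
    by have [pr _ _ rn] := mem_children rc; have := prime_gt0 pr; lia.
  by apply: rsum_le => r _ _; apply: sum_inv_children.
have rY n r : r \in children h j n -> (Y < r)%N.
  by case/mem_children => _ ry _ _; apply: leq_ltn_trans ry; rewrite leq_exp2l // hmono.
have B2 : \rsum_(n <- iota 1 N | has (fun r => r * r %| n - 1)%N (children h j n)) / INR n
    <= H * / INR Y.
  apply: (@Rle_trans _ (\rsum_(r <- iota 1 N | (Y < r)%N)
      \rsum_(n <- iota 1 N | (1 < n)%N && (r * r %| n - 1)%N) / INR n)).
    rewrite -(big_filter (iota 1 N) (fun r => Y < r)%N).
    apply: rsum_union_bound; first exact: inv_INR_ge0.
    move=> n; rewrite mem_iota => nN /hasP[r rc br]; exists r; rewrite ?mem_filter ?mem_iota ?(rY _ _ rc) ?br ?andbT.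
      by have [pr _ _ rn] := mem_children rc; have := prime_gt0 pr; lia.
    by have [pr _ _ rn] := mem_children rc; have := prime_gt0 pr; lia.
  apply: Rle_trans (Rmult_le_compat_l _ _ _ H0 (sum_inv_sqr N Y0)); rewrite -rsum_mull.
  apply: rsum_le => r _ Yr; have r0 : (0 < r)%N by lia.
  have rr0 : (0 < r * r)%N by rewrite muln_gt0 r0.
  by have := sum_inv_residue1 N rr0; rewrite INR_muln /Rdiv Rinv_mult -/H /= Rmult_1_r.
have B3 : \rsum_(n <- iota 1 N | has (fun t => has (fun r => has (fun r' =>
          [&& r != r', t \in desc h j r & t \in desc h j r'])
          (children h j n)) (children h j n)) (iota Y.+1 n)) / INR n
    <= H * ((1 + H) ^ j) ^ 2 * / INR Y.
  apply: (@Rle_trans _ (\rsum_(t <- iota 1 N | (Y < t)%N)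
      \rsum_(n <- iota 1 N | has (fun r => has (fun r' =>
          [&& r != r', t \in desc h j r & t \in desc h j r'])
          (children h j n)) (children h j n)) / INR n)).
    rewrite -(big_filter (iota 1 N) (fun r => Y < r)%N).
    apply: rsum_union_bound; first exact: inv_INR_ge0.
    move=> n; rewrite mem_iota => nN /hasP[t]; rewrite mem_iota => /andP[Yt _] Ht; exists t => //.
    rewrite mem_filter Yt mem_iota; move: Ht => /hasP[r rc /hasP[r' _ /and3P[_ tr _]]].
    by have [_ _ _ rn] := mem_children rc; have := desc_le tr; lia.
  apply: Rle_trans (Rmult_le_compat_l _ _ _ _ (sum_inv_sqr N Y0)); last by apply: Rmult_le_pos => //; apply: pow_le.
  rewrite -rsum_mull; apply: rsum_le => t _ Yt; have t0 : (0 < t)%N by lia.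
  have A := @sum_inv_ancestors h j N t t0; rewrite -/H in A.
  set s := [seq r <- iota 1 N | t \in desc h j r].
  have A' : \rsum_(r <- s) / INR r <= (1 + H) ^ j / INR t by rewrite big_filter.
  have mem_s n r : (n < 1 + N)%N -> r \in children h j n -> t \in desc h j r -> r \in s.
    move=> nN rc tr; rewrite mem_filter tr mem_iota.
    by have [pr _ _ rn] := mem_children rc; have := prime_gt0 pr; lia.
  apply: (@Rle_trans _ (\rsum_(r <- s) \rsum_(r' <- s) (H * (/ INR r * / INR r')))).
    apply: (@Rle_trans _ (\rsum_(r <- s) \rsum_(n <- iota 1 N | (r \in children h j n) &&
        has (fun r' => (r != r') && (t \in desc h j r')) (children h j n)) / INR n)).
      apply: rsum_union_bound; first exact: inv_INR_ge0.
      move=> n; rewrite mem_iota => /andP[_ nN] /hasP[r rc /hasP[r' rc' /and3P[ne tr tr']]].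
      by exists r; [apply: mem_s nN rc tr|rewrite rc; apply/hasP; exists r' => //; rewrite ne].
    apply: rsum_le => r rs _.
    apply: (@Rle_trans _ (\rsum_(r' <- s) \rsum_(n <- iota 1 N |
        [&& r \in children h j n, r' \in children h j n & r != r']) / INR n)).
      apply: rsum_union_bound; first exact: inv_INR_ge0.
      move=> n; rewrite mem_iota => /andP[_ nN] /andP[rc /hasP[r' rc' /andP[ne tr']]].
      by exists r'; [apply: mem_s nN rc' tr'|rewrite rc rc' ne].
    apply: rsum_le => r' r's _.
    have pos x : x \in s -> (0 < x)%N by rewrite mem_filter mem_iota => /and3P[_ ? _].
    have rr0 : (0 < r * r')%N by rewrite muln_gt0 !pos.
    have := sum_inv_residue1 N rr0; rewrite INR_muln /Rdiv Rinv_mult -/H; apply: Rle_trans.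
    apply: rsum_pred_le; first by move=> *; apply: inv_INR_ge0.
    move=> n _ /and3P[/mem_children[pr _ dr rn] /mem_children[pr' _ dr' _] ne].
    have cop : coprime r r' by rewrite prime_coprime // dvdn_prime2.
    by rewrite Gauss_dvd // dr dr' !andbT; have := prime_gt0 pr; lia.
  have S0 : 0 <= \rsum_(r <- s) / INR r by apply: rsum_ge0 => *; apply: inv_INR_ge0.
  set S := \rsum_(r <- s) / INR r in A' S0.
  have -> : \rsum_(r <- s) \rsum_(r' <- s) (H * (/ INR r * / INR r')) = H * (S * S).
    rewrite /S [X in _ = _ * X]big_distrl /= -rsum_mull; apply: eq_bigr => r _.
    by rewrite rsum_mull rsum_mull.
  have -> : H * ((1 + H) ^ j) ^ 2 * (/ INR t) ^ 2 = H * ((1 + H) ^ j / INR t * ((1 + H) ^ j / INR t)).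
    by rewrite /Rdiv; ring.
  by apply: Rmult_le_compat_l => //; apply: Rmult_le_compat.
apply: (@Rle_trans _ (H * (2 * INR j * (1 + H) ^ (2 * j + 1) * / INR Y) +
    (H * / INR Y + H * ((1 + H) ^ j) ^ 2 * / INR Y))).
  apply: Rle_trans (Rplus_le_compat _ _ _ _ B1 (Rplus_le_compat _ _ _ _ B2 B3)).
  rewrite big_mkcond [X in X + _]big_mkcond [X in _ + (X + _)]big_mkcond [X in _ + (_ + X)]big_mkcond.
  rewrite -!big_split /=; apply: rsum_le => n _ _; have in0 := inv_INR_ge0 n.
  by do !case: (has _ _) => /=; lra.
have -> : (2 * j.+1 + 1 = (2 * j + 1) + 2)%N by lia.
have -> : ((1 + H) ^ j) ^ 2 = (1 + H) ^ (2 * j)%N by rewrite -pow_mult; congr pow; lia.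
have -> : (1 + H) ^ (2 * j + 1 + 2)%N = (1 + H) ^ (2 * j)%N * (1 + H) ^ 3.
  by rewrite -pow_add; congr pow; lia.
have -> : (1 + H) ^ (2 * j + 1)%N = (1 + H) ^ (2 * j)%N * (1 + H) by rewrite pow_add pow_1.
have P1 : 1 <= (1 + H) ^ (2 * j)%N by apply: pow_R1_Rle; lra.
move: ((1 + H) ^ (2 * j)%N) P1 => P P1; rewrite S_INR; have j0 := pos_INR j; move: (INR j) j0 => J J0.
have -> : H * (2 * J * (P * (1 + H)) * / INR Y) + (H * / INR Y + H * P * / INR Y) =
  (H * (2 * J * (P * (1 + H))) + (H + H * P)) * / INR Y by ring.
apply: Rmult_le_compat_r; first lra.
have : H * (2 * J * (P * (1 + H))) <= 2 * J * (P * (1 + H) ^ 3).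
  have -> : H * (2 * J * (P * (1 + H))) = (2 * J * P) * (H * (1 + H)) by ring.
  have -> : 2 * J * (P * (1 + H) ^ 3) = (2 * J * P) * (1 + H) ^ 3 by ring.
  by apply: Rmult_le_compat_l; nra.
have : H + H * P <= 2 * (P * (1 + H) ^ 3).
  have : H <= (1 + H) ^ 3 by nra.
  move=> Hc; have : 0 <= (1 + H) ^ 3 by nra.
  by nra.
by lra.
Qed.

(** * Logarithmic mass of a tree *)

Definition tree_mass h j n := \rsum_(t <- desc h j n) ln (INR t).

Lemma tree_massS h j n :
  tree_mass h j.+1 n = ln (INR n) + \rsum_(r <- children h j n) tree_mass h j r.
Proof. by rewrite /tree_mass /= big_cons big_flatten big_map. Qed.

Lemma tree_mass_ge h j n : ln (INR n) <= tree_mass h j n.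
Proof.
rewrite /tree_mass; case: j => [|j] /=; first by rewrite big_seq1; lra.
rewrite big_cons; have : 0 <= \rsum_(t <- flatten [seq desc h j r | r <- children h j n]) ln (INR t).
  by apply: rsum_ge0 => t _ _; apply: ln_INR_ge0.
by lra.
Qed.

Lemma sum_ln_children_le h j n : \rsum_(r <- children h j n) ln (INR r) <= ln (INR n).
Proof.
case: (leqP n 1) => n1.
  have -> : children h j n = [::] by rewrite /children; have -> : (n - 1 = 0)%N by lia.
  by rewrite big_nil; apply: ln_INR_ge0.
have m0 : (0 < n - 1)%N by lia.
apply: (@Rle_trans _ (ln (INR (n - 1)))); last by apply: ln_INR_le; lia.
rewrite (ln_primes m0) /children big_filter.
apply: (@Rle_trans _ (\rsum_(p <- primes (n - 1)) ln (INR p))).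
  by apply: rsum_pred_le => // p _; apply: ln_INR_ge0.
apply: rsum_le => p; rewrite -logn_gt0 => /INR_ge1 l1 _.
by have := ln_INR_ge0 p; nra.
Qed.

(** The children of a node are distinct primes dividing n - 1, so no level has larger total
    logarithm than the one above it. *)
Lemma tree_mass_le h j n : tree_mass h j n <= INR j.+1 * ln (INR n).
Proof.
elim: j n => [|j IH] n; first by rewrite /tree_mass /= big_seq1; lra.
rewrite tree_massS [INR j.+2]S_INR.
have : \rsum_(r <- children h j n) tree_mass h j r <= INR j.+1 * ln (INR n).
  apply: (@Rle_trans _ (INR j.+1 * \rsum_(r <- children h j n) ln (INR r))).
    by rewrite -rsum_mull; apply: rsum_le => r _ _; apply: IH.
  by apply: Rmult_le_compat_l; [exact: pos_INR|exact: sum_ln_children_le].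
by lra.
Qed.

(** Expanded, this is the sum over all chains descending from n of the product of the smooth weights
    along the chain. It dominates the worst chain, which governs the mass, and unlike a maximum it
    is linear in the children, so its moments obey a recursion. *)
Fixpoint tree_factor (h : nat -> nat) j n : R :=
  if j is j'.+1 then
    smooth_weight (h j') (n - 1) * (1 + \rsum_(r <- children h j' n) tree_factor h j' r)
  else 1.

Lemma smooth_weight_ge1 h a : (0 < h)%N -> 1 <= smooth_weight h a.
Proof.
move=> h0; have L := ln2_bounds; have h0' := INR_gt0 h0.
apply: Rle_trans (exp_ineq1_le _); rewrite -[X in X <= _]Rplus_0_r; apply: Rplus_le_compat_l.
apply: Rmult_le_pos; first exact: smooth_log_ge0.
by left; apply: Rinv_0_lt_compat; nra.
Qed.

Lemma tree_factor_ge1 h j n : (forall i, (0 < h i)%N) -> 1 <= tree_factor h j n.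
Proof.
move=> h0; elim: j n => [|j IH] n /=; first lra.
have := @smooth_weight_ge1 (h j) (n - 1) (h0 j).
have : 0 <= \rsum_(r <- children h j n) tree_factor h j r.
  by apply: rsum_ge0 => r _ _; have := IH r; lra.
by nra.
Qed.

Lemma ln_pred_le_smooth h j n : (1 < n)%N ->
  ~~ has (fun r => r * r %| n - 1)%N (children h j n) ->
  ln (INR (n - 1)) <= smooth_log (h j) (n - 1) + \rsum_(r <- children h j n) ln (INR r).
Proof.
move=> n1 /hasPn sqf; have m0 : (0 < n - 1)%N by lia.
rewrite {1}(ln_primes m0) (bigID (fun p => p <= 2 ^ h j)%N) /=; apply: Rplus_le_compat.
  rewrite -big_filter; apply: rsum_subset; first by rewrite filter_uniq // primes_uniq.
    by move=> p; rewrite mem_filter mem_primes mem_primes_le => /and3P[-> -> _].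
  by move=> p _; apply: Rmult_le_pos; [exact: pos_INR|exact: ln_INR_ge0].
rewrite /children big_filter (eq_bigl (fun p => 2 ^ h j < p)%N) => [|p]; last by rewrite ltnNge.
apply: rsum_le => p pn pY.
have pc : p \in children h j n by rewrite mem_filter pY.
have := sqf p pc; have [pp _ _ _] := mem_children pc.
rewrite -[(p * p)%N]/(p ^ 2)%N pfactor_dvdn // -ltnNge => l2.
have : INR (logn p (n - 1)) <= 1 by apply: (@INR_leq _ 1).
by have := ln_INR_ge0 p; nra.
Qed.

(* A node n loses at most its smooth part from the mass of each of the
   at most k levels below it. *)
Lemma tree_mass_lower_bound h j k n rho : (j <= k)%N -> (0 < rho)%N -> (forall i, (0 < h i)%N) ->
  (forall i, h i.+1 = rho * h i)%N -> prime n -> (2 ^ h j < n)%N -> ~~ collides h j n ->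
  ln (INR n) * (INR j.+1 - 4 * INR k * ln (tree_factor h j n) / INR rho) <= tree_mass h j n.
Proof.
move=> jk rho0 h0 hS; have L := ln2_bounds; have rho0' := INR_gt0 rho0.
elim: j n jk => [|j IH] n jk pn nY nb.
  by rewrite ln_1 /tree_mass big_seq1 [INR 1]/=; right; field; lra.
have n1 := prime_gt1 pn.
have n2 : (2 < n)%N by apply: leq_ltn_trans nY; rewrite -{1}(expn1 2) leq_exp2l.
rewrite /= !negb_or in nb; case/and3P: nb => /hasPn nb sqf _.
have lower := ln_pred_le_smooth n1 sqf.
have fge r := @tree_factor_ge1 h j r h0.
set S := \rsum_(r <- children h j n) tree_factor h j r.
have S0 : 0 <= S by apply: rsum_ge0 => r _ _; have := fge r; lra.
set M := ln (1 + S); have M0 : 0 <= M by apply: ln_ge0; lra.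
set ell := smooth_log (h j) (n - 1) in lower.
have hj := INR_gt0 (h0 j).
have lnE : ln (smooth_weight (h j) (n - 1) * (1 + S)) = ell / (2 * (INR (h j) * ln 2)) + M.
  rewrite ln_mult; [|exact: exp_pos|lra].
  by rewrite /smooth_weight ln_exp.
rewrite -[tree_factor h j.+1 n]/(smooth_weight (h j) (n - 1) * (1 + S)) lnE tree_massS [INR j.+2]S_INR.
set c := 4 * INR k / INR rho.
have c0 : 0 <= c by apply: Rmult_le_pos; [have := pos_INR k; lra|left; apply: Rinv_0_lt_compat].
have -> x : 4 * INR k * x / INR rho = c * x by rewrite /c; field; lra.
have lnn := ln_INR_ge0 n.
(* As n is odd, the smooth part of n - 1 contains a factor 2, which pays for replacing ln (n - 1) by
   ln n. *)
have ell_ge : ln 2 <= ell.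
  have p2 : 2%N \in primes_le (2 ^ h j).
    by rewrite mem_primes_le /= -{1}(expn1 2) leq_exp2l.
  have /= := @rsum_ge_term _ _ (fun p => INR (logn p (n - 1)) * ln (INR p)) _ p2.
  rewrite -/(smooth_log (h j) (n - 1)) -/ell -[1 + 1]/2 => H.
  apply: Rle_trans (H _); last by move=> i _; apply: Rmult_le_pos; [exact: pos_INR|exact: ln_INR_ge0].
  have : 1 <= INR (logn 2 (n - 1)).
    apply: INR_ge1; rewrite logn_gt0 mem_primes /= subn_gt0 n1 dvdn2 oddB ?(ltnW n1) //=.
    by case: (even_prime pn) => [E|->] //; rewrite E in n2.
  by nra.
(* The node exceeds the rho-th power of the cutoff 2^(h j), so the share of the smooth weight in the
   bound outweighs the loss of (ln 2 + ell) <= 2 ell on at most k levels. This fixes the 4 in c = 4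
   k / rho. *)
have key : 2 * INR k * ell <= c * (ln (INR n) * (ell / (2 * (INR (h j) * ln 2)))).
  have lnY : INR rho * (INR (h j) * ln 2) <= ln (INR n).
    have Y0 : (0 < 2 ^ h j.+1)%N by rewrite expn_gt0.
    by have := ln_INR_le Y0 (ltnW nY); rewrite ln_exp2 hS INR_muln; lra.
  have -> : c * (ln (INR n) * (ell / (2 * (INR (h j) * ln 2)))) =
    (2 * INR k * ell) * (ln (INR n) * / (INR rho * (INR (h j) * ln 2))) by rewrite /c; field; lra.
  have q1 : 1 <= ln (INR n) * / (INR rho * (INR (h j) * ln 2)).
    have d0 : 0 < INR rho * (INR (h j) * ln 2) by apply: Rmult_lt_0_compat => //; nra.
    by apply: (Rmult_le_reg_r (INR rho * (INR (h j) * ln 2))) => //; rewrite Rmult_assoc Rinv_l; lra.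
  have : 0 <= 2 * INR k * ell by have := pos_INR k; nra.
  by nra.
have mass : \rsum_(r <- children h j n) (ln (INR r) * (INR j.+1 - c * M)) <=
    \rsum_(r <- children h j n) tree_mass h j r.
  apply: rsum_le => r rc _; have [pr rY _ _] := mem_children rc.
  have := IH r (ltnW jk) pr rY (nb r rc).
  have -> x : 4 * INR k * x / INR rho = c * x by rewrite /c; field; lra.
  apply: Rle_trans; apply: Rmult_le_compat_l; first exact: ln_INR_ge0.
  have : ln (tree_factor h j r) <= M.
    apply: ln_le; first by have := fge r; lra.
    have := @rsum_ge_term _ _ (tree_factor h j) r rc; rewrite -/S => H.
    have : tree_factor h j r <= S by apply: H => i _; have := fge i; lra.
    by lra.
  by nra.
move: mass; rewrite -big_distrl.
have T0 : 0 <= \rsum_(r <- children h j n) ln (INR r) by apply: rsum_ge0 => r _ _; apply: ln_INR_ge0.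
have lnpred : ln (INR n) - ln 2 <= ln (INR (n - 1)).
  have : ln (INR n) <= ln (INR (2 * (n - 1))) by apply: ln_INR_le; lia.
  rewrite INR_muln ln_mult; [|by rewrite /=; lra|by apply: INR_gt0; lia].
  by rewrite -[INR 2]/2; lra.
set T := \rsum_(r <- children h j n) ln (INR r) in T0 lower *.
set W := \rsum_(r <- children h j n) tree_mass h j r => mass.
have {}mass : T * (INR j.+1 - c * M) <= W := mass.
have W0 : 0 <= W.
  apply: rsum_ge0 => r _ _; apply: Rle_trans (tree_mass_ge h j r); exact: ln_INR_ge0.
have jkR : INR j.+1 <= INR k by apply: INR_leq.
have j0 := pos_INR j.+1.
set e := ell / (2 * (INR (h j) * ln 2)) in key *.
move: (INR j.+1) (INR k) jkR j0 key mass => J K JK J0 key mass.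
move: (ln (INR n)) (ln (INR (n - 1))) lnn lnpred lower key => l l' l0 lnpred lower key.
(* For a negative coefficient the lower bound on T is of no use, but then ln n and W >= 0 already
   suffice. *)
case: (Rle_lt_dec 0 (J - c * M)) => sgn.
  have : (l - ln 2 - ell) * (J - c * M) <= T * (J - c * M) by apply: Rmult_le_compat_r; lra.
  have : (ln 2 + ell) * (J - c * M) <= 2 * K * ell.
    have h1 : (ln 2 + ell) * (J - c * M) <= (2 * ell) * J.
      have : 0 <= c * M by nra.
      move=> cM; apply: (@Rle_trans _ ((2 * ell) * (J - c * M))); first by apply: Rmult_le_compat_r; lra.
      by apply: Rmult_le_compat_l; lra.
    by apply: Rle_trans h1 _; nra.
  by lra.
have : 0 <= 2 * K * ell by nra.
have : l * (J - c * M) <= 0 by nra.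
by lra.
Qed.

(** * Existence of a good root *)

Lemma smooth_log_mul h r a : prime r -> (2 ^ h < r)%N -> (0 < a)%N ->
  smooth_log h (r * a) = smooth_log h a.
Proof.
move=> pr rh a0; rewrite /smooth_log big_seq [RHS]big_seq; apply: eq_bigr => p.
have r0 := prime_gt0 pr.
rewrite mem_primes_le => /andP[pp ph]; rewrite lognM // logn_prime //.
by case: eqP => // E; rewrite E in ph; lia.
Qed.

Definition tree_moment h j X :=
  \rsum_(q <- iota 1 X | prime q && (2 ^ h j < q)%N) (tree_factor h j q / INR q).

Lemma tree_factor_ge0 h j n : (forall i, (0 < h i)%N) -> 0 <= tree_factor h j n.
Proof. by move=> h0; have := @tree_factor_ge1 h j n h0; lra. Qed.

Lemma tree_moment_ge0 h j X : (forall i, (0 < h i)%N) -> 0 <= tree_moment h j X.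
Proof.
move=> h0; apply: rsum_ge0 => q _ _; apply: Rmult_le_pos; first exact: tree_factor_ge0.
exact: inv_INR_ge0.
Qed.

(** Write q = r a + 1 with r a child of q. As r exceeds the cutoff, q - 1 and a have the same smooth
    part, so for fixed r the sum over a is a weighted sum over primes in a progression, at most K /
    phi(r) <= 2 K / r. The summand 1 of [tree_factor] is the case r = 1. *)
Lemma tree_moment_rec h j L t : (forall i, (2 <= h i)%N) -> (0 < L)%N ->
  18 + 12 * ln (INR L) <= INR t ->
  tree_moment h j.+1 (2 ^ L) <=
  41 * exp 32 * INR t ^ 2 * (1 + 2 * tree_moment h j (2 ^ L)).
Proof.
move=> h2 L0 ht; set K := 41 * exp 32 * INR t ^ 2; set X := (2 ^ L)%N.
have h0 i : (0 < h i)%N by have := h2 i; lia.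
have K0 : 0 <= K.
  by rewrite /K; have := exp_pos 32; have := pow2_ge_0 (INR t); nra.
have F0 r := @tree_factor_ge0 h j r h0.
have sw0 a : 0 <= smooth_weight (h j) a by left; apply: exp_pos.
have swq0 a b : 0 <= smooth_weight (h j) a / INR b.
  by apply: Rmult_le_pos => //; apply: inv_INR_ge0.
have prog r : (0 < r)%N -> (forall a, (0 < a)%N -> smooth_log (h j) (r * a) = smooth_log (h j) a) ->
    \rsum_(q <- iota 1 X | prime q && (r %| q - 1)%N) (smooth_weight (h j) (q - 1) / INR q) <=
    / INR r * \rsum_(a <- iota 1 X | prime (r * a + 1)) (smooth_weight (h j) a / INR a).
  move=> r0 slE.
  apply: (@Rle_trans _ (\rsum_(a <- iota 1 X | prime (r * a + 1))
      (smooth_weight (h j) (r * a + 1 - 1) / INR (r * a + 1)))).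
    apply: (@rsum_le_map _ _ _ _ _ _ (fun a => r * a + 1)%N (fun q => smooth_weight (h j) (q - 1) / INR q)).
    - exact: iota_uniq.
    - move=> q; rewrite mem_iota => qX /andP[pq /dvdnP[a an]]; have q1 := prime_gt1 pq.
      have qE : q = (r * a + 1)%N by rewrite mulnC -an; lia.
      by exists a => //; rewrite mem_iota -qE pq andbT; nia.
    - by move=> *; apply: swq0.
  rewrite -rsum_mull; apply: rsum_le => a; rewrite mem_iota => /andP[a0 _] _.
  rewrite addnK /smooth_weight slE // -/(smooth_weight (h j) a).
  have -> : / INR r * (smooth_weight (h j) a / INR a) = smooth_weight (h j) a * / INR (r * a).
    by rewrite INR_muln Rinv_mult /Rdiv; ring.
  apply: Rmult_le_compat_l => //; apply: Rinv_le_contravar.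
    by apply: INR_gt0; rewrite muln_gt0 r0.
  by apply: INR_leq; lia.
have P1 : \rsum_(q <- iota 1 X | prime q && (2 ^ h j.+1 < q)%N) (smooth_weight (h j) (q - 1) / INR q) <= K.
  apply: (@Rle_trans _ (\rsum_(q <- iota 1 X | prime q && (1 %| q - 1)%N) (smooth_weight (h j) (q - 1) / INR q))).
    by apply: rsum_pred_le => // q _ /andP[-> _]; rewrite dvd1n.
  apply: Rle_trans (prog 1%N isT _) _; first by move=> a _; rewrite mul1n.
  have tr1 : totient_ratio 1 = 1 by rewrite /totient_ratio /=; field.
  rewrite -[INR 1]/(1) Rinv_1 Rmult_1_l.
  apply: Rle_trans (@smooth_weight_progression (h j) L t 1 (h2 j) L0 ht isT _) _.
    by move=> p pp _; rewrite Euclid_dvd1.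
  by rewrite tr1 -/K; lra.
have P2 : \rsum_(q <- iota 1 X | prime q && (2 ^ h j.+1 < q)%N)
    (smooth_weight (h j) (q - 1) / INR q * \rsum_(r <- children h j q) tree_factor h j r)
    <= 2 * K * tree_moment h j X.
  apply: (@Rle_trans _ (\rsum_(q <- iota 1 X | prime q) \rsum_(r <- iota 1 X | r \in children h j q)
      (smooth_weight (h j) (q - 1) / INR q * tree_factor h j r))).
    apply: (@Rle_trans _ (\rsum_(q <- iota 1 X | prime q)
      (smooth_weight (h j) (q - 1) / INR q * \rsum_(r <- children h j q) tree_factor h j r))).
      apply: rsum_pred_le => [q _|q _ /andP[]//].
      by apply: Rmult_le_pos => //; apply: rsum_ge0.
    apply: rsum_le => q; rewrite mem_iota => qX _; rewrite -rsum_mull -[X in _ <= X]big_filter.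
    apply: rsum_subset; first by rewrite filter_uniq // primes_uniq.
      move=> r rc; rewrite mem_filter rc mem_iota.
      by have [pr _ _ rq] := mem_children rc; have := prime_gt0 pr; lia.
    by move=> r _; apply: Rmult_le_pos.
  under eq_bigr => q _ do rewrite big_mkcond.
  rewrite exchange_big /=.
  rewrite /tree_moment -rsum_mull [X in _ <= X]big_mkcond /=; apply: rsum_le => r.
  rewrite mem_iota => rX _; case: ifP => [/andP[pr rY]|nr]; last first.
    rewrite big1 => [|q _]; first lra.
    by case: ifP => // /mem_children[pr rY _ _]; rewrite pr rY in nr.
  have r0 := prime_gt0 pr; have r0' := INR_gt0 r0.
  rewrite -big_mkcondr /=.
  apply: (@Rle_trans _ (tree_factor h j r * \rsum_(q <- iota 1 X | prime q && (r %| q - 1)%N) (smooth_weight (h j) (q - 1) / INR q))).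
    rewrite -rsum_mull; under eq_bigr => q _ do rewrite Rmult_comm.
    apply: rsum_pred_le; first by move=> q _; apply: Rmult_le_pos.
    by move=> q _ /andP[-> /mem_children[_ _ -> _]].
  have -> : 2 * K * (tree_factor h j r / INR r) = tree_factor h j r * (/ INR r * (K * 2)).
    by rewrite /Rdiv; ring.
  apply: Rmult_le_compat_l => //.
  apply: Rle_trans (prog r r0 _) _; first by move=> a; apply: smooth_log_mul.
  apply: Rmult_le_compat_l; first by left; apply: Rinv_0_lt_compat.
  apply: Rle_trans (@smooth_weight_progression (h j) L t r (h2 j) L0 ht r0 _) _.
    move=> p pp ph; rewrite dvdn_prime2 //; apply/eqP => E; rewrite E in ph; lia.
  rewrite -/K; apply: Rmult_le_compat_l => //.
  rewrite /totient_ratio totient_prime // -subn1 INR_subn1 //.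
  have p2 := INR_prime_ge2 pr; apply: (Rmult_le_reg_r (INR r - 1)); first lra.
  have -> : INR r / (INR r - 1) * (INR r - 1) = INR r by field; lra.
  by lra.
have -> : tree_moment h j.+1 X =
  \rsum_(q <- iota 1 X | prime q && (2 ^ h j.+1 < q)%N) (smooth_weight (h j) (q - 1) / INR q) +
  \rsum_(q <- iota 1 X | prime q && (2 ^ h j.+1 < q)%N)
    (smooth_weight (h j) (q - 1) / INR q * \rsum_(r <- children h j q) tree_factor h j r).
  rewrite -big_split; apply: eq_bigr => q _.
  by rewrite [LHS]/= /Rdiv; set S := \rsum_(r <- children h j q) tree_factor h j r; rewrite /=; ring.
by lra.
Qed.

(** Following 1 + U instead of U makes the recursion U' <= K (1 + 2 U) a plain multiplication by 1 +
    2 K. *)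
Lemma tree_moment_bound h k L t : (forall i, (2 <= h i)%N) -> (0 < L)%N ->
  18 + 12 * ln (INR L) <= INR t ->
  1 + tree_moment h k (2 ^ L) <=
  (1 + 82 * exp 32 * INR t ^ 2) ^ k * (1 + harmonic (2 ^ L)).
Proof.
move=> h2 L0 ht; have h0 i : (0 < h i)%N by have := h2 i; lia.
have K0 : 0 <= 41 * exp 32 * INR t ^ 2.
  by have := exp_pos 32; have := pow2_ge_0 (INR t); nra.
elim: k => [|k IH].
  rewrite Rmult_1_l; apply: Rplus_le_compat_l; rewrite /tree_moment /harmonic.
  under eq_bigr => q _ do rewrite /= /Rdiv Rmult_1_l.
  by rewrite [X in _ <= X](eq_bigl xpredT) //; apply: rsum_pred_le => // q _; apply: inv_INR_ge0.
have := @tree_moment_rec h k L t h2 L0 ht; have U0 := @tree_moment_ge0 h k (2 ^ L) h0.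
set K := 41 * exp 32 * INR t ^ 2 in K0 *; move: IH.
have -> : 82 * exp 32 * INR t ^ 2 = 2 * K by rewrite /K; ring.
rewrite -(tech_pow_Rmult _ k) (Rmult_assoc (1 + 2 * K)).
move: (tree_moment h k _) U0 (tree_moment h k.+1 _) (_ ^ k * _) => U U0 U' P IH Hr.
have : (1 + 2 * K) * (1 + U) <= (1 + 2 * K) * P by apply: Rmult_le_compat_l; lra.
by lra.
Qed.

(** Chebyshev leaves at least 2^L / (4 L) primes after discarding those up to 2^n, with L = 2 n, and
    each is weighted at least 2^(-L). *)
Lemma sum_inv_primes_interval n : (6 <= n)%N ->
  / (4 * INR (2 * n)) <= \rsum_(q <- iota 1 (2 ^ (2 * n)) | prime q && (2 ^ n < q)%N) / INR q.
Proof.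
move=> n6; set L := (2 * n)%N; have L0 : (0 < L)%N by rewrite /L; lia.
have XL : (0 < 2 ^ L)%N by rewrite expn_gt0.
have X0 := INR_gt0 XL; have L0' := INR_gt0 L0.
set s := [seq q <- iota 1 (2 ^ L) | prime q && (2 ^ n < q)%N].
have szs : (size (primes_le (2 ^ L)) <= size s + 2 ^ n)%N.
  rewrite -(size_iota 1 (2 ^ n)) -size_cat; apply: uniq_leq_size; first exact: primes_le_uniq.
  move=> p; rewrite mem_primes_le mem_cat mem_filter !mem_iota => /andP[pp pX].
  by rewrite pp prime_gt0 //= !add1n !ltnS pX andbT; case: ltnP.
have pnt := size_primes_le L.-1; rewrite prednK // in pnt.
have e2 : (2 ^ L = 2 * 2 ^ L.-1)%N by rewrite -expnS prednK.
have e3 : (2 ^ L = 2 ^ n * 2 ^ n)%N by rewrite /L mul2n -addnn expnD.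
have big : (4 * L <= 2 ^ n)%N.
  rewrite /L; elim: (n) n6 => [//|k IH] k6; rewrite expnS.
  have [E|k6'] : (k = 5)%N \/ (6 <= k)%N by lia.
    by rewrite E.
  by have := IH k6'; lia.
have main : (2 ^ L <= 4 * L * size s)%N.
  have : (2 ^ L <= 2 * L * size s + 2 * L * 2 ^ n)%N by nia.
  have : (4 * L * 2 ^ n <= 2 ^ L)%N by rewrite e3 leq_mul2r big orbT.
  by lia.
rewrite -big_filter -/s; apply: (@Rle_trans _ (\rsum_(q <- s) / INR (2 ^ L))); last first.
  apply: rsum_le => q; rewrite mem_filter mem_iota => /and3P[_ q0 qX] _.
  by apply: Rinv_le_contravar; [exact: INR_gt0|apply: INR_leq; lia].
rewrite rsum_const; move: (INR_leq main); rewrite (INR_muln (4 * L)) (INR_muln 4 L).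
have -> : INR 4 = 4 by rewrite /=; lra.
move=> main'; apply: (Rmult_le_reg_r (4 * INR L * INR (2 ^ L))); first by apply: Rmult_lt_0_compat => //; lra.
have -> : / (4 * INR L) * (4 * INR L * INR (2 ^ L)) = INR (2 ^ L) by field; lra.
by have -> : INR (size s) * / INR (2 ^ L) * (4 * INR L * INR (2 ^ L)) = 4 * INR L * INR (size s) by field; lra.
Qed.

(** The candidate primes carry logarithmic mass at least 1 / (4 L). Half of it is allotted to
    collisions and half, by Markov's inequality, to roots whose [tree_factor] exceeds Theta; both
    bounds being strict, a root remains. *)
Lemma good_prime_exists h k t Theta (L := (2 * h k)%N) :
  (forall i, (2 <= h i)%N) -> {homo h : x y / (x <= y)%N} -> (6 <= h k)%N ->
  18 + 12 * ln (INR L) <= INR t ->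
  2 * INR k * (1 + harmonic (2 ^ L)) ^ (2 * k + 1) * / INR (2 ^ h 0%N) < / (8 * INR L) ->
  (1 + 82 * exp 32 * INR t ^ 2) ^ k * (1 + harmonic (2 ^ L)) < Theta * / (8 * INR L) ->
  exists q, [/\ prime q, (2 ^ h k < q <= 2 ^ L)%N, ~~ collides h k q & tree_factor h k q <= Theta].
Proof.
move=> h2 hmono h6 ht C1 C2; have h0 i : (0 < h i)%N by have := h2 i; lia.
have L0 : (0 < L)%N by rewrite /L; have := h2 k; lia.
have L0' := INR_gt0 L0.
have i8 : 0 < / (8 * INR L) by apply: Rinv_0_lt_compat; lra.
have Th0 : 0 < Theta.
  have : 0 < Theta * / (8 * INR L).
    apply: Rle_lt_trans C2; apply: Rmult_le_pos; last by have := harmonic_ge0 (2 ^ L); lra.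
    by apply: pow_le; have := exp_pos 32; have := pow2_ge_0 (INR t); nra.
  by nra.
have U := @tree_moment_bound h k L t h2 L0 ht.
set s := iota 1 (2 ^ L).
pose good q := [&& prime q, (2 ^ h k < q)%N, ~~ collides h k q & Rle_dec (tree_factor h k q) Theta : bool].
have [/hasP[q]|/hasPn nogood] := boolP (has good s).
  rewrite mem_iota => qX /and4P[pq qY nq]; case: Rle_dec => // Hq _; exists q; split=> //.
  by rewrite qY; lia.
exfalso; have := sum_inv_primes_interval h6; rewrite -/L -/s; apply: Rlt_not_le.
have S1 := @sum_inv_collides h k (2 ^ L) hmono; rewrite -/s in S1.
apply: (@Rle_lt_trans _ (\rsum_(q <- s | collides h k q) / INR q + / Theta * tree_moment h k (2 ^ L))).
  rewrite /tree_moment -rsum_mull -/s big_mkcond [X in _ <= X + _]big_mkcond [X in _ <= _ + X]big_mkcond.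
  rewrite -big_split /=; apply: rsum_le => q qs _; have iq := inv_INR_ge0 q.
  have F0 := @tree_factor_ge0 h k q h0.
  have iT : 0 < / Theta by apply: Rinv_0_lt_compat.
  have pos : 0 <= / Theta * (tree_factor h k q / INR q) by apply: Rmult_le_pos; [lra|apply: Rmult_le_pos].
  case: ifP => [/andP[pq qY]|_]; last by case: ifP => _; lra.
  have := nogood q qs; rewrite /good pq qY /=; case: ifP => /= [_ _|_]; first lra.
  case: Rle_dec => // Hq _.
  have HT : Theta <= tree_factor h k q by lra.
  have : / INR q <= / Theta * (tree_factor h k q / INR q).
    have -> : / Theta * (tree_factor h k q / INR q) = (/ Theta * tree_factor h k q) * / INR q.
      by rewrite /Rdiv; ring.
    have : 1 <= / Theta * tree_factor h k q.
      by apply: (Rmult_le_reg_l Theta) => //; rewrite -Rmult_assoc Rinv_r; lra.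
    by nra.
  by lra.
have -> : / (4 * INR L) = / (8 * INR L) + / (8 * INR L) by field; lra.
apply: Rplus_lt_compat; first exact: Rle_lt_trans S1 C1.
apply: (Rmult_lt_reg_l Theta) => //; rewrite -Rmult_assoc Rinv_r; last lra.
by lra.
Qed.

(** * The lower bound for f *)

Lemma dvdn_biglcm_seq (s : seq nat) (F : nat -> nat) p : p \in s ->
  (F p %| \big[lcmn/1%N]_(i <- s) F i)%N.
Proof. by move=> ps; rewrite (big_rem p ps) /= dvdn_lcml. Qed.

(** For squarefree m the two totients cancel. Each t in s divides some p - 1, a divisor of the
    Carmichael value, and distinct primes dividing separately divide jointly; the root q is all that
    is lost. *)
Lemma f_fun_prod_primes q (s : seq nat) : uniq (q :: s) -> all prime (q :: s) ->
  (forall t, t \in s -> exists2 p, p \in q :: s & (t %| p - 1)%N) ->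
  (\prod_(t <- s) t %| f_fun (\prod_(t <- q :: s) t))%N.
Proof.
move=> us ps H; set m := (\prod_(t <- q :: s) t)%N.
have m0 : (0 < m)%N.
  by rewrite /m big_seq_cond; apply: prodn_cond_gt0 => t /andP[/(allP ps)/prime_gt0].
have mem_pm t : (t \in primes m) = (t \in q :: s).
  rewrite mem_primes m0 /=; apply/andP/idP => [[pt]|ts]; last first.
    by split; [exact: (allP ps)|rewrite /m (big_rem t ts) /= dvdn_mulr].
  rewrite /m Euclid_dvd_prod // big_has => /hasP[r rs].
  by rewrite dvdn_prime2 //; [move/eqP ->|exact: (allP ps)].
have rad_m : rad m = m.
  by rewrite /rad; apply: perm_big; apply: uniq_perm => //; exact: primes_uniq.
rewrite /f_fun rad_m mulnK ?totient_gt0 // dvdn_gcd; apply/andP; split.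
  by rewrite /m big_cons dvdn_mull.
apply: dvdn_mull; apply: prod_primes_dvd; first by case/andP: us.
  by case/andP: ps.
move=> t ts; have [p pin tp] := H t ts.
have pt : prime t by apply: (allP ps); rewrite inE ts orbT.
have pp : prime p by apply: (allP ps).
apply: dvdn_trans (_ : _ %| carmichael_pp p (logn p m))%N _; last first.
  by apply: (@dvdn_biglcm_seq _ (fun p => carmichael_pp p (logn p m))); rewrite mem_pm.
(* An odd p avoids the exceptional branch of [carmichael_pp] at powers of 2. *)
have p2 : (2 < p)%N.
  by have := prime_gt1 pt; have := prime_gt1 pp; move=> p1 t1; have := dvdn_leq (_ : 0 < p - 1)%N tp; lia.
by rewrite /carmichael_pp ifF ?dvdn_mull //; apply/negP => /andP[/eqP E _]; rewrite E in p2.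
Qed.

Lemma desc_prime h j n : prime n -> all prime (desc h j n).
Proof.
elim: j n => [|j IH] n pn /=; rewrite pn //=.
by apply/allP => t /flatten_mapP[r /mem_children[pr _ _ _] tr]; apply: (allP (IH r pr)).
Qed.

Lemma desc_cons h j n : desc h j n = n :: behead (desc h j n).
Proof. by case: j. Qed.

Lemma desc_parent h j n t : t \in behead (desc h j n) ->
  exists2 p, p \in desc h j n & (t %| p - 1)%N.
Proof.
elim: j n => [//|j IH] n /= /flatten_mapP[r rc].
have sub p : p \in desc h j r -> p \in desc h j.+1 n.
  by move=> pr; rewrite /= in_cons; apply/orP; right; apply/flatten_mapP; exists r.
rewrite desc_cons in_cons => /orP[/eqP ->|/IH[p pr tp]].
  by exists n; [rewrite mem_head|have [] := mem_children rc].
by exists p => //; apply: sub.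
Qed.

Lemma f_fun_tree h j q : prime q -> uniq (desc h j q) ->
  let m := (\prod_(t <- desc h j q) t)%N in
  [/\ (q <= m)%N, ln (INR m) = tree_mass h j q &
      tree_mass h j q - ln (INR q) <= ln (INR (f_fun m))].
Proof.
move=> pq us m; have ap := desc_prime h j pq; have q0 := prime_gt0 pq.
have pos t : t \in desc h j q -> (0 < t)%N by move/(allP ap)/prime_gt0.
have mE : m = (q * \prod_(t <- behead (desc h j q)) t)%N by rewrite /m {1}desc_cons big_cons.
have b0 : (0 < \prod_(t <- behead (desc h j q)) t)%N.
  by rewrite big_seq_cond; apply: prodn_cond_gt0 => t /andP[/mem_behead/pos].
have lnm : ln (INR m) = tree_mass h j q.
  by rewrite /m INR_prod ln_rprod // => t /pos t0 _; apply: INR_gt0.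
split=> //; first by rewrite mE leq_pmulr.
rewrite -lnm mE INR_muln ln_mult; try exact: INR_gt0.
have -> x y : x + y - x = y by lra.
apply: ln_INR_le => //; rewrite -mE; apply: dvdn_leq.
  by rewrite /f_fun gcdn_gt0 mE muln_gt0 q0 b0.
rewrite /m {2}desc_cons; apply: f_fun_prod_primes; rewrite -desc_cons //.
by move=> t; apply: desc_parent.
Qed.

(** * Choice of the parameters *)

Lemma ln_INR_exp2 g : ln (INR (2 ^ g)) <= INR g.
Proof. by rewrite ln_exp2; have := ln2_bounds; have := pos_INR g; nra. Qed.

Lemma ltn_60_exp2 g : (10 <= g)%N -> (60 * g < 2 ^ g)%N.
Proof.
elim: g => [//|g IH] g10; rewrite expnS.
have [E|g10'] : (g = 9)%N \/ (10 <= g)%N by lia.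
  by rewrite E.
by have := IH g10'; lia.
Qed.

(** The ratio rho = k g^2 with k = 2^g: the log-weight of a good root is O(k g), so the relative
    loss O(k g / rho) is O(1/g), while ln rho is still asymptotic to ln k. *)
Definition level_base g := (2 ^ g * (g * g))%N.
(** The lowest exponent k^3 beats the collision factor, whose logarithm is O(k^2 g). *)
Definition level_exp g i := (2 ^ (3 * g) * level_base g ^ i)%N.

(* With k = 2^g levels the losses in tree_mass_lower_bound amount to a factor 1 - O(1/g). *)
Lemma good_tree_exists : exists g0 : nat, forall g, (g0 <= g)%N ->
  exists q, [/\ prime q, (2 ^ level_exp g (2 ^ g) < q <= 2 ^ (2 * level_exp g (2 ^ g)))%N,
    uniq (desc (level_exp g) (2 ^ g) q) &
    ln (INR q) * (INR (2 ^ g) * (1 - 80 / INR g)) <= tree_mass (level_exp g) (2 ^ g) q].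
Proof.
(* With t = 100 k g the growth per generation is 1 + 82 e^32 t^2, where 82 * 100^2 = 820000; it is
   at most C0 k^4 since g <= k. *)
set C0 := 1 + 820000 * exp 32.
have C01 : 1 <= C0 by rewrite /C0; have := exp_pos 32; lra.
have [n0 n0C] := INR_unbounded (ln C0).
exists (maxn 10 n0) => g; rewrite geq_max => /andP[g10 gn0].
have lC : ln C0 <= INR g by have := INR_leq gn0; lra.
set k := (2 ^ g)%N; set h := level_exp g; set L := (2 * h k)%N.
have L2 := ln2_bounds.
have k0 : (0 < k)%N by rewrite expn_gt0.
have kg : (60 * g < k)%N := ltn_60_exp2 g10.
have g0 : (0 < g)%N by lia.
have b0 : (0 < level_base g)%N by rewrite /level_base muln_gt0 k0 muln_gt0 g0.
have h8 i : (8 <= h i)%N.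
  rewrite /h /level_exp; apply: leq_trans (leq_pmulr _ _); last by rewrite expn_gt0 b0.
  by rewrite -[8%N]/(2 ^ 3)%N leq_exp2l //; lia.
have hS i : h i.+1 = (level_base g * h i)%N by rewrite /h /level_exp expnS mulnCA.
have hmono : {homo h : x y / (x <= y)%N}.
  by move=> x y xy; rewrite /h /level_exp leq_mul2l leq_pexp2l ?orbT.
have G10 : 10 <= INR g.
  by have -> : 10 = INR 10 by [rewrite /=; lra]; apply: INR_leq.
have KG : 60 * INR g < INR k.
  by have := INR_ltn kg; rewrite INR_muln; have -> : INR 60 = 60 by [rewrite /=; lra].
have lnk : ln (INR k) <= INR g by exact: ln_INR_exp2.
have L0 : (0 < L)%N by rewrite /L; have := h8 k; lia.
have L0' := INR_gt0 L0.
set G := INR g in lC G10 KG lnk *; set K := INR k in KG lnk *.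
have lng : ln G <= G by have := @ln_le_sub1 G; lra.
have lnL : ln (INR L) <= 5 * K * G.
  have -> : INR L = INR 2 * (INR (2 ^ (3 * g)) * (K * (G * G)) ^ k).
    rewrite /L /h /level_exp /level_base -/k 2!INR_muln; congr (_ * (_ * _)).
    by rewrite INR_expn !INR_muln.
  have p0 : 0 < K * (G * G) by apply: Rmult_lt_0_compat; nra.
  have pk : 0 < (K * (G * G)) ^ k by apply: pow_lt.
  have u0 : 0 < INR (2 ^ (3 * g)) by apply: INR_gt0; rewrite expn_gt0.
  rewrite ln_mult; [|by rewrite /=; lra|by apply: Rmult_lt_0_compat].
  rewrite ln_mult // ln_pow // !ln_mult; try nra.
  have := ln_INR_exp2 (3 * g); rewrite INR_muln -/G; have -> : INR 3 = 3 by rewrite /=; lra.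
  have -> : ln (INR 2) = ln 2 by []; rewrite -/K; move=> Hu.
  have : K * (ln K + (ln G + ln G)) <= K * (3 * G) by apply: Rmult_le_compat_l; lra.
  have : 60 * G <= K * G by nra.
  by lra.
(* The sieve asks for 18 + 12 ln L <= t, and ln L <= 5 k g. *)
set t := (100 * k * g)%N.
have tE : INR t = 100 * K * G.
  by rewrite /t !INR_muln; have -> : INR 100 = 100 by rewrite /=; lra.
have KG1 : 600 <= K * G by nra.
have ht : 18 + 12 * ln (INR L) <= INR t by rewrite tE; lra.
set H1 := 1 + harmonic (2 ^ L).
have H1p : 1 <= H1 by rewrite /H1; have := harmonic_ge0 (2 ^ L); lra.
have lnH : ln H1 <= 6 * K * G.
  have H2 : H1 <= 3 * INR L.
    rewrite /H1; have [_] := harmonic_bounds (2 ^ L); rewrite expn_gt0 => /(_ isT).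
    by rewrite ln_exp2; have := INR_ge1 L0; nra.
  apply: (@Rle_trans _ (ln (3 * INR L))); first by apply: ln_le; lra.
  by rewrite ln_mult; [have := @ln_le_sub1 3; lra|lra|lra].
set P := (1 + 82 * exp 32 * INR t ^ 2) ^ k.
have base_ge1 : 1 <= 1 + 82 * exp 32 * INR t ^ 2.
  by have := exp_pos 32; have := pow2_ge_0 (INR t); nra.
have P1 : 1 <= P by apply: pow_R1_Rle.
have lnP : ln P <= 5 * K * G.
  rewrite /P ln_pow; last lra.
  have : ln (1 + 82 * exp 32 * INR t ^ 2) <= 5 * G; last by rewrite -/K; nra.
  apply: (@Rle_trans _ (ln (C0 * K ^ 4))).
    apply: ln_le; first lra.
    rewrite tE /C0; have e0 := exp_pos 32.
    have : (K * G) ^ 2 <= K ^ 4.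
      have -> : K ^ 4 = (K ^ 2) ^ 2 by ring.
      by apply: pow_incr; nra.
    have : 1 <= K ^ 4 by apply: pow_R1_Rle; lra.
    by nra.
  by rewrite ln_mult; [rewrite ln_pow; [have -> : INR 4 = 4 by [rewrite /=; lra]; lra|lra]|lra|apply: pow_lt; lra].
(* Twice the threshold required by Markov's inequality. *)
set Theta := 16 * INR L * (P * H1).
have PH : 1 <= P * H1 by nra.
have lnTheta : ln Theta <= 20 * K * G.
  rewrite /Theta ln_mult; [|lra|lra]; rewrite ln_mult; [|lra|lra]; rewrite ln_mult; [|lra|lra].
  by have := @ln_le_sub1 16; nra.
have h2 i : (2 <= h i)%N by have := h8 i; lia.
have h1 i : (0 < h i)%N by have := h8 i; lia.
have h6 : (6 <= h k)%N by have := h8 k; lia.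
have [||q [pq qr nc fT]] := @good_prime_exists h k t Theta h2 hmono h6 ht.
- rewrite -/L -/H1 -/K.
  have hE0 : h 0%N = (k ^ 3)%N by rewrite /h /level_exp expn0 muln1 mulnC expnM.
  rewrite hE0; set D := INR (2 ^ k ^ 3).
  have D0 : 0 < D by apply: INR_gt0; rewrite expn_gt0.
  have lnD : 30 * K ^ 2 * G < ln D.
    rewrite /D ln_exp2 INR_expn -/K.
    have : 60 * G * K ^ 2 < K * K ^ 2 by apply: Rmult_lt_compat_r => //; apply: pow_lt; lra.
    have : 0 < K ^ 3 by apply: pow_lt; lra.
    by move=> K3 KK; have : K ^ 3 / 2 <= K ^ 3 * ln 2; nra.
  have num0 : 0 < 2 * K * H1 ^ (2 * k + 1)%N by apply: Rmult_lt_0_compat; [lra|apply: pow_lt; lra].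
  suff : 2 * K * H1 ^ (2 * k + 1)%N * (8 * INR L) < D.
    move=> HD; apply: (Rmult_lt_reg_r (D * (8 * INR L))); first by apply: Rmult_lt_0_compat; lra.
    have -> : 2 * K * H1 ^ (2 * k + 1)%N * / D * (D * (8 * INR L)) = 2 * K * H1 ^ (2 * k + 1)%N * (8 * INR L) by field; lra.
    by have -> : / (8 * INR L) * (D * (8 * INR L)) = D by field; lra.
  apply: ln_lt_inv => //; first by apply: Rmult_lt_0_compat; lra.
  rewrite ln_mult; [|lra|lra]; rewrite ln_mult; [|lra|by apply: pow_lt; lra].
  rewrite ln_mult; [|lra|lra]; rewrite ln_mult; [|lra|lra]; rewrite ln_pow; last lra.
  have -> : INR (2 * k + 1) = 2 * K + 1 by rewrite INR_addn INR_muln.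
  have := @ln_le_sub1 8; have : (2 * K + 1) * ln H1 <= (2 * K + 1) * (6 * K * G) by apply: Rmult_le_compat_l; lra.
  have : 600 * K <= K * G * K by apply: Rmult_le_compat_r; lra.
  have : 60 * G * K <= K * G * K by nra.
  by nra.
- rewrite -/L -/H1 -/P /Theta.
  have -> : 16 * INR L * (P * H1) * / (8 * INR L) = 2 * (P * H1) by field; lra.
  by lra.
exists q; split=> //; first exact: desc_uniq.
have qY : (2 ^ h k < q)%N by case/andP: qr.
have := @tree_mass_lower_bound h k k q (level_base g) (leqnn k) b0 h1 hS pq qY nc.
apply: Rle_trans; apply: Rmult_le_compat_l; first exact: ln_INR_ge0.
have fge := @tree_factor_ge1 h k q h1.
have lf : ln (tree_factor h k q) <= 20 * K * G by apply: Rle_trans lnTheta; apply: ln_le; lra.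
rewrite S_INR /level_base !INR_muln -/k -/K -/G.
(* The constant 80 is 4 * 20, from the mass bound and from ln Theta <= 20 k g. *)
have : 4 * K * ln (tree_factor h k q) / (K * (G * G)) <= 80 * K / G; last first.
  by have -> : K * (1 - 80 / G) = K - 80 * K / G by [field; lra]; lra.
apply: (Rmult_le_reg_r (K * (G * G))); first nra.
have -> : 4 * K * ln (tree_factor h k q) / (K * (G * G)) * (K * (G * G)) = 4 * K * ln (tree_factor h k q) by field; lra.
have -> : 80 * K / G * (K * (G * G)) = 4 * K * (20 * K * G) by field; lra.
by apply: Rmult_le_compat_l; lra.
Qed.

Lemma ln_level_exp g : (0 < g)%N ->
  ln (INR (level_exp g (2 ^ g))) =
  3 * INR g * ln 2 + INR (2 ^ g) * (INR g * ln 2 + 2 * ln (INR g)).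
Proof.
move=> g0; have G0 := INR_gt0 g0; have L := ln2_bounds.
have k0 : 0 < INR (2 ^ g) by apply: INR_gt0; rewrite expn_gt0.
have u0 : 0 < INR (2 ^ (3 * g)) by apply: INR_gt0; rewrite expn_gt0.
rewrite /level_exp INR_muln [X in _ * X]INR_expn /level_base !INR_muln.
have p0 : 0 < INR (2 ^ g) * (INR g * INR g) by apply: Rmult_lt_0_compat => //; nra.
rewrite ln_mult //; last exact: pow_lt.
rewrite ln_pow // ln_mult //; last nra.
rewrite ln_mult // !ln_exp2 INR_muln; have -> : INR 3 = 3 by rewrite /=; lra.
ring.
Qed.

(** Put l = ln q and W = ln m. Then ln f(m) >= W - l while W is at least (1 - 80/g) k l, so the
    exponent lost is about 1/k. Moreover ln W is at most k ln k up to lower order and ln ln W >= ln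
    k, which compares 1/k with logloglog m / loglog m. *)
Lemma f_fun_large (e : R) N : 0 < e -> exists m, [/\ (N <= m)%N, 0 < ln (INR m),
  0 < ln (ln (INR m)), 0 < ln (ln (ln (INR m))) &
  (ln (INR m) - ln (INR (f_fun m))) * ln (ln (INR m))
  <= (1 + e) * ln (INR m) * ln (ln (ln (INR m)))].
Proof.
move=> e0; have L2 := ln2_bounds.
have [g0 Hg0] := good_tree_exists.
(* Chosen so that y = sqrt g satisfies y >= 20 and e y >= 40. *)
have [n1 Hn1] := INR_unbounded ((20 + 40 / e) ^ 2).
set g := (maxn (maxn g0 N) (maxn n1 400))%N.
have [gg0 gN gn1 g400] : [/\ g0 <= g, N <= g, n1 <= g & 400 <= g]%N by rewrite /g; split; lia.
have [q [pq /andP[qY qX] ud massL]] := Hg0 g gg0.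
have gpos : (0 < g)%N by lia.
set k := (2 ^ g)%N in qY qX ud massL; set h := level_exp g in qY qX ud massL.
have [] := f_fun_tree pq ud; set m := (\prod_(t <- desc h k q) t)%N => qm lnm lnf.
have massU := tree_mass_le h k q; set W := tree_mass h k q in lnm lnf massL massU.
set G := INR g in massL; set K := INR k in massL.
have G400 : 400 <= G.
  by have -> : 400 = INR 400 by [rewrite INR_IZR_INZ]; apply: INR_leq.
have kg : (60 * g < k)%N by apply: ltn_60_exp2; lia.
have KG : 60 * G < K.
  by have := INR_ltn kg; rewrite INR_muln; have -> : INR 60 = 60 by [rewrite /=; lra].
have hk := ln_level_exp gpos; rewrite -/k -/h -/G -/K in hk.
have lng0 : 0 <= ln G by apply: ln_ge0; lra.
set l := ln (INR q) in massL massU lnf.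
have hk8 : (0 < h k)%N by rewrite /h /level_exp /level_base !muln_gt0 !expn_gt0 !muln_gt0 expn_gt0 gpos.
have hkp := INR_gt0 hk8.
have lL : INR (h k) * ln 2 <= l.
  have Y0 : (0 < 2 ^ h k)%N by rewrite expn_gt0.
  by have := ln_INR_le Y0 (ltnW qY); rewrite ln_exp2.
have lU : l <= 2 * INR (h k) * ln 2.
  have := ln_INR_le (prime_gt0 pq) qX; rewrite ln_exp2 INR_muln -[INR 2]/2 -/l; lra.
have l0 : 0 < l by nra.
have Wl : l <= W by apply: tree_mass_ge.
have W0 : 0 < W by lra.
set Lam := ln W.
have LamU : Lam <= K * (G * ln 2 + 2 * ln G) + K.
  have WU : W <= (2 * K) * (2 * INR (h k)).
    apply: Rle_trans massU _; rewrite S_INR -/K.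
    apply: (@Rle_trans _ ((2 * K) * l)); first by apply: Rmult_le_compat_r; lra.
    apply: Rmult_le_compat_l; nra.
  have := ln_le W0 WU; rewrite -/Lam ln_mult; [|lra|lra].
  rewrite ln_mult; [|lra|lra]; rewrite ln_mult; [|lra|lra]; rewrite hk.
  have := ln_INR_exp2 g; rewrite -/k -/K -/G.
  have : 3 * G * ln 2 <= 3 * G by nra.
  by lra.
have LamL : K * G * ln 2 <= Lam.
  have : ln (INR (h k) * ln 2) <= Lam.
    by apply: ln_le; [nra|lra].
  rewrite ln_mult; [|lra|lra]; rewrite hk.
  have : - 1 <= ln (ln 2).
    have : ln (/ 2) <= ln (ln 2) by apply: ln_le; lra.
    by rewrite ln_Rinv; lra.
  have : 0 <= K * (2 * ln G) by apply: Rmult_le_pos; lra.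
  have : 3 * G * / 2 <= 3 * G * ln 2 by apply: Rmult_le_compat_l; lra.
  by lra.
have lnLam : G * ln 2 <= ln Lam.
  have KG2 : 0 < K * (G * ln 2) by apply: Rmult_lt_0_compat; nra.
  have : ln (K * (G * ln 2)) <= ln Lam by apply: ln_le => //; lra.
  rewrite ln_mult; [|lra|nra]; rewrite /K /k ln_exp2 -/G.
  have : 0 <= ln (G * ln 2) by apply: ln_ge0; nra.
  by lra.
have Lam0 : 0 < Lam by have : 0 < K * G * ln 2 by [apply: Rmult_lt_0_compat; nra]; lra.
have lnLam0 : 0 < ln Lam by nra.
exists m; rewrite lnm -/Lam; split=> //.
  apply: leq_trans qm; apply: leq_trans (ltnW qY); apply: leq_trans gN _.
  apply: leq_trans (ltnW (ltn_expl _ _)); last by [].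
  apply: (@leq_trans (2 ^ (3 * g))); last by rewrite leq_pmulr // expn_gt0 /level_base !muln_gt0 expn_gt0 gpos.
  by apply: leq_trans (ltnW (ltn_expl _ (isT : 1 < 2)%N)); lia.
apply: (@Rle_trans _ (l * Lam)); first by apply: Rmult_le_compat_r; lra.
(* ln G <= 2 sqrt G, so the choice of n1 makes 2 ln G + O(1) small against e G. *)
have fin : G * ln 2 + 2 * ln G + 1 <= (1 + e) * (1 - 80 / G) * (G * ln 2).
  have -> : (1 + e) * (1 - 80 / G) * (G * ln 2) = (1 + e) * (G - 80) * ln 2 by field; lra.
  set y := sqrt G; have y0 : 0 <= y by apply: sqrt_pos.
  have yy : y * y = G by apply: sqrt_sqrt; lra.
  have y20 : 20 + 40 / e <= y.
    apply: Rsqr_incr_0; [|have : 0 < 40 / e by [apply: Rmult_lt_0_compat; [lra|exact: Rinv_0_lt_compat]]; lra|lra].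
    rewrite /Rsqr yy; have := INR_leq gn1; rewrite -/G; lra.
  have ey : 40 <= e * y.
    have : e * (20 + 40 / e) <= e * y by apply: Rmult_le_compat_l; lra.
    have -> : e * (20 + 40 / e) = 20 * e + 40 by field; lra.
    by lra.
  have y20' : 20 <= y by have : 0 < 40 / e by [apply: Rmult_lt_0_compat; [lra|exact: Rinv_0_lt_compat]]; lra.
  have lnG : ln G <= 2 * y.
    rewrite -yy ln_mult; [|lra|lra]; have := @ln_le_sub1 y; lra.
  have : 80 * e <= e * G / 4 by nra.
  have : 10 * y <= e * G / 4 by rewrite -yy; nra.
  by nra.
have fin2 : Lam <= (1 + e) * (K * (1 - 80 / G)) * (G * ln 2).
  apply: Rle_trans LamU _.
  have := Rmult_le_compat_l K _ _ _ fin; move=> H; have {}H := H (Rlt_le _ _ _); nra.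
have pos80 : 0 <= 1 - 80 / G.
  have : 80 / G <= 80 / 400 by apply: Rmult_le_compat_l; [lra|apply: Rinv_le_contravar; lra].
  by lra.
apply: (@Rle_trans _ (l * ((1 + e) * (K * (1 - 80 / G)) * (G * ln 2)))).
  by apply: Rmult_le_compat_l; lra.
have -> : l * ((1 + e) * (K * (1 - 80 / G)) * (G * ln 2)) =
  (1 + e) * (l * (K * (1 - 80 / G))) * (G * ln 2) by ring.
apply: Rmult_le_compat => //; first by apply: Rmult_le_pos; [lra|apply: Rmult_le_pos; [lra|nra]].
- nra.
- by apply: Rmult_le_compat_l; lra.
Qed.

(** * The extremal set and its error function *)

Lemma inv_INRS_lt e : 0 < e -> exists n : nat, / INR n.+1 < e.
Proof.
move=> e0; have [n Hn] := INR_unbounded (/ e); exists n.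
rewrite -(Rinv_inv e); apply: Rinv_lt_contravar; last by rewrite S_INR; lra.
apply: Rmult_lt_0_compat; [exact: Rinv_0_lt_compat|exact: INR_gt0].
Qed.

(* The least epsilon for which the bound of (ii) holds at m. *)
Definition f_excess m :=
  (ln (INR m) - ln (INR (f_fun m))) * ln (ln (INR m)) / (ln (INR m) * ln (ln (ln (INR m)))) - 1.

(** Made boolean, through the decidability of the order on the reals, so that [ex_minn] can select
    one m for each i. *)
Definition f_extremal i m : bool :=
  [&& (i <= m)%N, Rlt_dec 0 (ln (INR m)) : bool, Rlt_dec 0 (ln (ln (INR m))) : bool,
    Rlt_dec 0 (ln (ln (ln (INR m)))) : bool & Rle_dec (f_excess m) (/ INR i.+1) : bool].

Lemma f_extremalP i m : f_extremal i m -> [/\ (i <= m)%N, 0 < ln (INR m),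
  0 < ln (ln (INR m)), 0 < ln (ln (ln (INR m))) & f_excess m <= / INR i.+1].
Proof.
rewrite /f_extremal => /and5P[im]; case: Rlt_dec => // h1 _; case: Rlt_dec => // h2 _.
by case: Rlt_dec => // h3 _; case: Rle_dec.
Qed.

Lemma f_extremal_exists i : exists m, f_extremal i m.
Proof.
have i0 : 0 < / INR i.+1 by apply: Rinv_0_lt_compat; apply: INR_gt0.
have [m [im h1 h2 h3 H]] := f_fun_large i i0; exists m.
apply/and5P; split=> //; try by case: Rlt_dec.
case: Rle_dec => // ne; exfalso; apply: ne; rewrite /f_excess.
have D0 : 0 < ln (INR m) * ln (ln (ln (INR m))) by apply: Rmult_lt_0_compat.
set D := ln (INR m) * ln (ln (ln (INR m))) in D0 *; set A := _ * ln (ln (INR m)) in H *.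
have : A / D <= 1 + / INR i.+1; last lra.
apply: (Rmult_le_reg_r D) => //; rewrite /Rdiv Rmult_assoc Rinv_l; last lra.
by rewrite Rmult_1_r /D -Rmult_assoc.
Qed.

Lemma ln_INR_gt0_pos m : 0 < ln (INR m) -> (0 < m)%N.
Proof.
case: (posnP m) => // -> H; exfalso; apply: Rlt_irrefl (_ : 0 < 0); move: H.
by rewrite {1}/ln; case: Rlt_dec => //= H0; case: (Rlt_irrefl _ H0).
Qed.

Lemma f_fun_excess_bound m eps : 0 < ln (INR m) -> 0 < ln (ln (INR m)) ->
  0 < ln (ln (ln (INR m))) -> f_excess m <= eps ->
  Rpower (INR m) (1 - (1 + eps) * ln (ln (ln (INR m))) / ln (ln (INR m))) <= INR (f_fun m).
Proof.
move=> h1 h2 h3 he.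
have m0 := ln_INR_gt0_pos h1.
have f0 : 0 < INR (f_fun m) by apply: INR_gt0; rewrite /f_fun gcdn_gt0 m0.
rewrite -(exp_ln (INR (f_fun m))) // /Rpower.
suff : (1 - (1 + eps) * ln (ln (ln (INR m))) / ln (ln (INR m))) * ln (INR m) <= ln (INR (f_fun m)).
  by case=> [H|->]; [left; apply: exp_increasing|right].
move: he; rewrite /f_excess.
move: (ln (INR (f_fun m))) (ln (ln (ln (INR m)))) h3 => F c c0.
move: (ln (ln (INR m))) h2 => b b0; move: (ln (INR m)) h1 => a a0 he.
have {}he : (a - F) * b / (a * c) * (a * c) <= (1 + eps) * (a * c).
  by apply: Rmult_le_compat_r; [nra|lra].
have E : (a - F) * b / (a * c) * (a * c) = (a - F) * b by field; lra.
rewrite E in he; apply: (Rmult_le_reg_r b) => //.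
have -> : (1 - (1 + eps) * c / b) * a * b = a * b - (1 + eps) * (a * c) by field; lra.
by lra.
Qed.

Local Close Scope R_scope.
Delimit Scope R_scope with R.

Theorem theorem1p1 :
  (forall m : nat, (1 <= m)%nat ->
     (INR (d_fun m) <=
      sqrt 2 * INR m *
      exp (- sqrt (ln 2 * ln (INR m) + (ln 2) ^ 2 / 4)))%R)
  /\
  (exists (M : nat -> Prop) (eps : nat -> R),
     (forall m, M m -> (0 < m)%nat) /\
     (forall N : nat, exists m, M m /\ (N <= m)%nat) /\
     (forall e : R, (0 < e)%R ->
        exists N : nat, forall m, M m -> (N <= m)%nat -> (Rabs (eps m) < e)%R) /\
     (forall m, M m -> (0 < ln (ln (INR m)))%R ->
        (Rpower (INR m)
           (1 - (1 + eps m) * ln (ln (ln (INR m))) / ln (ln (INR m))) <=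
         INR (f_fun m))%R)).
Proof.
split; first exact: d_fun_upper_bound.
pose F i := ex_minn (f_extremal_exists i).
have FP i : f_extremal i (F i) by rewrite /F; case: ex_minnP.
(* The excess is only bounded from above and might be very negative; truncating it at 0 makes it
   tend to 0 and keeps the lower bound valid. *)
exists (fun m => exists i, m = F i), (fun m => Rmax R0 (f_excess m)); split; [|split; [|split]].
- by move=> m [i ->]; have [_ /ln_INR_gt0_pos h1 _ _ _] := f_extremalP (FP i).
- by move=> N; exists (F N); split; [exists N|have [] := f_extremalP (FP N)].
- move=> e e0; have [n ne] := inv_INRS_lt e0.
  (* This exceeds every F i with i <= n, so an element of the set beyond it has an index larger than
     n. *)
  exists (\sum_(i < n.+1) F i).+1 => m [i ->] mN.
  have ni : n < i.
    rewrite ltnNge; apply/negP => iN; move: mN.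
    by rewrite (bigD1 (Ordinal (iN : i < n.+1))) //= => H; lia.
  have [_ _ _ _ H] := f_extremalP (FP i).
  have : (/ INR i.+1 <= / INR n.+1)%R.
    by apply: Rinv_le_contravar; [exact: INR_gt0|apply: INR_leq; lia].
  by rewrite Rabs_pos_eq; [move=> ?; apply: Rmax_lub_lt; lra|apply: Rmax_l].
- move=> m [i ->] _; have [_ h1 h2 h3 _] := f_extremalP (FP i).
  by apply: f_fun_excess_bound => //; apply: Rmax_r.
Qed.
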